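(* For an ultra-Noetherian local ring $R_\natural$, the following are equivalent: (1) $R_\natural$ is pseudo-regular; (2) $R_\natural$ is ultra-regular; (3) $R_\natural$ is cata-regular and isodimensional.
   Context: Local rings are not assumed Noetherian; the embedding dimension is the minimal number of generators of the maximal ideal. Fix an infinite index set with a countably incomplete non-principal ultrafilter; ''almost all $w$'' means for all $w$ in a member of the ultrafilter. An ultra-Noetherian local ring $R_\natural$ is an ultraproduct of Noetherian local rings $R_w$ of bounded embedding dimension (for some $m$, almost all $R_w$ have embedding dimension at most $m$); it is ultra-regular if almost all $R_w$ are regular. Let $(R,\mathfrak m)$ be a local ring of finite embedding dimension. Its depth is $n-h$, where $\mathfrak m$ is generated by $\mathbf x=(x_1,\dots,x_n)$ and $h$ is the largest $i$ with Koszul homology $H_i(\mathbf x;R)\neq0$. $R$ is pseudo-regular if its depth equals its embedding dimension, and cata-regular if its completion $\widehat R=\varprojlim R/\mathfrak m^n$ is a regular (Noetherian) local ring. The geometric dimension of $R$ is the least number of elements of $\mathfrak m$ generating an ideal $I$ with $R/I$ Artinian. An associated prime of an ideal $J$ is a prime of the form $(J:a)$; it is a minimal associated prime of $J$ if it properly contains no associated prime of $J$. The pi-dimension of $R$ is the least $d$ such that $\mathfrak m$ is a minimal associated prime of an ideal generated by $d$ elements. $R$ is isodimensional if its geometric dimension equals its pi-dimension; for an ultra-Noetherian local ring this is equivalent to the common Krull dimension of almost all $R_w$ being equal to the Krull dimension of $\widehat{R_\natural}$. *)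

(* Defs.v *)
From HB Require Import structures.
From mathcomp Require Import all_boot all_order all_algebra ring_quotient.
From mathcomp Require Import all_classical.

Set Implicit Arguments.
Unset Strict Implicit.
Unset Printing Implicit Defensive.

Import GRing.Theory.

Local Open Scope classical_set_scope.
Local Open Scope quotient_scope.
Local Open Scope ring_scope.

(* Rings are [comPzRingType]s, i.e. commutative rings with unit in which [1 = 0]
   is allowed, so that [R / I] and arbitrary products exist without side
   conditions; a local ring is automatically nontrivial since its maximal ideal
   is proper.  The ideals of [ring_quotient] are boolean, proper, and require
   [1 != 0]; here an ideal is any (classical) set with the usual closure
   properties. *)
Record ideal (R : comPzRingType) := Ideal {
  ideal_set :> set R;
  ideal_0 : ideal_set 0;
  ideal_D : forall x y, ideal_set x -> ideal_set y -> ideal_set (x + y);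
  ideal_M : forall a x, ideal_set x -> ideal_set (a * x) }.

Definition ideal_has (R : comPzRingType) (I : ideal R) (x : R) : Prop :=
  ideal_set I x.
Coercion ideal_has : ideal >-> Funclass.

Lemma ideal_eqP (R : comPzRingType) (I J : ideal R) :
  I = J <-> I = J :> set R.
Proof.
split=> [->//|]; case: I J => [I I0 ID IM] [J J0 JD JM] /= IJ; subst J.
by congr Ideal; exact: Prop_irrelevance.
Qed.

Section Ideals.
Variable R : comPzRingType.
Implicit Types (I J M P Q : ideal R) (A : set R).

Definition unit_ideal : ideal R.
Proof. by exists setT. Defined.

(* The ideal generated by A: the intersection of all ideals containing A. *)
Definition ideal_gen A : ideal R.
Proof.
exists [set x | forall I, A `<=` I -> I x].
- by move=> I _; exact: ideal_0.
- by move=> x y hx hy I AI; apply: ideal_D; [exact: hx|exact: hy].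
- by move=> a x hx I AI; apply: ideal_M; exact: hx.
Defined.

Definition ideal_mul I J : ideal R :=
  ideal_gen [set z | exists x y, [/\ I x, J y & z = x * y]].

Definition ideal_pow I (n : nat) : ideal R := iter n (ideal_mul I) unit_ideal.

Definition ideal_colon I (a : R) : ideal R.
Proof.
exists [set r | I (r * a)].
- by rewrite /= mul0r; exact: ideal_0.
- by move=> x y hx hy; rewrite /= mulrDl; exact: ideal_D.
- by move=> b x hx; rewrite /= -mulrA; exact: ideal_M.
Defined.

Definition prime_ideal P : Prop :=
  ~ P 1 /\ forall x y, P (x * y) -> P x \/ P y.

Definition maximal_ideal M : Prop :=
  ~ M 1 /\ forall J, M `<=` J -> ~ J 1 -> J `<=` M.

(* R is a local ring and M is its maximal ideal. *)
Definition local_ring M : Prop :=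
  maximal_ideal M /\ forall J, maximal_ideal J -> J = M.

Definition generated_by I (n : nat) : Prop :=
  exists x : 'I_n -> R, I = ideal_gen (range x).

Definition noetherian : Prop := forall I, exists n, generated_by I n.

Definition artinian : Prop :=
  forall I : nat -> ideal R, (forall n, I n.+1 `<=` I n) ->
  exists N, forall n, (N <= n)%N -> I n = I N.

Definition associated_prime J P : Prop :=
  prime_ideal P /\ exists a, P = ideal_colon J a.

Definition minimal_associated_prime J P : Prop :=
  associated_prime J P /\ forall Q, associated_prime J Q -> ~ (Q `<` P).

End Ideals.

Definition is_least (P : nat -> Prop) (d : nat) : Prop :=
  P d /\ forall e, P e -> (d <= e)%N.

Definition is_greatest (P : nat -> Prop) (d : nat) : Prop :=
  P d /\ forall e, P e -> (e <= d)%N.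

Section Quotient.
Variables (R : comPzRingType) (I : ideal R).

Definition ideal_pred (x : R) : bool := `[< I x >].

Fact ideal_pred_zmod_closed : zmod_closed ideal_pred.
Proof.
split=> [|x y /asboolP Ix /asboolP Iy]; apply/asboolP; first exact: ideal_0.
by rewrite -[- y]mulN1r; apply: ideal_D => //; exact: ideal_M.
Qed.
Definition ideal_zmodClosed : zmodClosed R :=
  HB.pack_for (zmodClosed R) ideal_pred
    (GRing.isZmodClosed.Build R ideal_pred ideal_pred_zmod_closed).

Definition quot_ring : Type := Quotient.quot ideal_zmodClosed.
HB.instance Definition _ := GRing.Zmodule.on quot_ring.

Definition quot_pi (x : R) : quot_ring :=
  \pi_(Quotient.quot ideal_zmodClosed) x.

Lemma quot_pi_eq x y : quot_pi x = quot_pi y <-> I (x - y).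
Proof.
split; first by move=> /eqP; rewrite -Quotient.idealrBE => /asboolP.
by move=> Ixy; apply/eqP; rewrite -Quotient.idealrBE; exact/asboolP.
Qed.

Lemma quot_pi_surj (u : quot_ring) : exists x, u = quot_pi x.
Proof. by exists (repr u); rewrite /quot_pi reprK. Qed.

Definition quot_one : quot_ring := quot_pi 1.
Definition quot_mul (u v : quot_ring) : quot_ring :=
  quot_pi (repr u * repr v).

Lemma quot_piM x y : quot_mul (quot_pi x) (quot_pi y) = quot_pi (x * y).
Proof.
apply/quot_pi_eq.
have hx : I (repr (quot_pi x) - x) by apply/quot_pi_eq; rewrite /quot_pi reprK.
have hy : I (repr (quot_pi y) - y) by apply/quot_pi_eq; rewrite /quot_pi reprK.
set a := repr _ in hx *; set b := repr _ in hy *.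
have -> : a * b - x * y = b * (a - x) + x * (b - y).
  by rewrite !mulrBr [b * a]mulrC [b * x]mulrC addrA subrK.
by apply: ideal_D; exact: ideal_M.
Qed.

Lemma quot_piD x y : quot_pi (x + y) = quot_pi x + quot_pi y.
Proof. exact: Quotient.pi_add. Qed.

Fact quot_mulA : associative quot_mul.
Proof.
move=> u v w; have [x ->] := quot_pi_surj u; have [y ->] := quot_pi_surj v.
by have [z ->] := quot_pi_surj w; rewrite !quot_piM mulrA.
Qed.

Fact quot_mulC : commutative quot_mul.
Proof. by move=> u v; rewrite /quot_mul mulrC. Qed.

Fact quot_mul1 : left_id quot_one quot_mul.
Proof. by move=> u; have [x ->] := quot_pi_surj u; rewrite quot_piM mul1r. Qed.

Fact quot_mulD : left_distributive quot_mul +%R.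
Proof.
move=> u v w; have [x ->] := quot_pi_surj u; have [y ->] := quot_pi_surj v.
by have [z ->] := quot_pi_surj w; rewrite -quot_piD !quot_piM mulrDl quot_piD.
Qed.

HB.instance Definition _ := GRing.Zmodule_isComPzRing.Build quot_ring
  quot_mulA quot_mulC quot_mul1 quot_mulD.

Fact quot_pi_zmod_morphism : zmod_morphism quot_pi.
Proof.
move=> x y; rewrite quot_piD; congr (_ + _).
exact: Quotient.pi_opp.
Qed.
Fact quot_pi_monoid_morphism : monoid_morphism quot_pi.
Proof. by split=> // x y; rewrite -quot_piM. Qed.
HB.instance Definition _ :=
  GRing.isZmodMorphism.Build R quot_ring quot_pi quot_pi_zmod_morphism.
HB.instance Definition _ :=
  GRing.isMonoidMorphism.Build R quot_ring quot_pi quot_pi_monoid_morphism.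

End Quotient.

Section Product.
Variables (W : Type) (A : W -> comPzRingType).

Definition prod_ring : Type := forall w, A w.
HB.instance Definition _ := Choice.on prod_ring.

Let add (f g : prod_ring) : prod_ring := fun w => f w + g w.
Let opp (f : prod_ring) : prod_ring := fun w => - f w.
Let zero : prod_ring := fun=> 0.
Let one : prod_ring := fun=> 1.
Let mul (f g : prod_ring) : prod_ring := fun w => f w * g w.

Fact prod_addA : associative add.
Proof. by move=> f g h; apply: functional_extensionality_dep => w; exact: addrA. Qed.
Fact prod_addC : commutative add.
Proof. by move=> f g; apply: functional_extensionality_dep => w; exact: addrC. Qed.
Fact prod_add0 : left_id zero add.
Proof. by move=> f; apply: functional_extensionality_dep => w; exact: add0r. Qed.
Fact prod_addN : left_inverse zero opp add.
Proof. by move=> f; apply: functional_extensionality_dep => w; exact: addNr. Qed.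
Fact prod_mulA : associative mul.
Proof. by move=> f g h; apply: functional_extensionality_dep => w; exact: mulrA. Qed.
Fact prod_mulC : commutative mul.
Proof. by move=> f g; apply: functional_extensionality_dep => w; exact: mulrC. Qed.
Fact prod_mul1 : left_id one mul.
Proof. by move=> f; apply: functional_extensionality_dep => w; exact: mul1r. Qed.

HB.instance Definition _ := GRing.isZmodule.Build prod_ring
  prod_addA prod_addC prod_add0 prod_addN.

Fact prod_mulD : left_distributive mul +%R.
Proof. by move=> f g h; apply: functional_extensionality_dep => w; exact: mulrDl. Qed.

HB.instance Definition _ := GRing.Zmodule_isComPzRing.Build prod_ring
  prod_mulA prod_mulC prod_mul1 prod_mulD.

End Product.

Section Ultraproduct.
Variables (W : Type) (F : set_system W) (FF : Filter F).
Variable A : W -> comPzRingType.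

Definition null_ideal : ideal (prod_ring A).
Proof.
exists [set f : prod_ring A | \forall w \near F, f w = 0].
- by apply: filterE.
- move=> f g hf hg; near=> w.
  rewrite (_ : (f + g) w = f w + g w) //.
  by rewrite (near hf w) // (near hg w) // addr0.
- move=> f g hg; near=> w.
  by rewrite (_ : (f * g) w = f w * g w) // (near hg w) // mulr0.
Unshelve. all: by end_near. Defined.

(* The ultraproduct of the rings A w (for F an ultrafilter): families modulo
   equality for almost all w. *)
Definition ultraproduct : comPzRingType := quot_ring null_ideal.

End Ultraproduct.
Arguments ultraproduct [W] F {FF} A.

Section Completion.
Variables (R : comPzRingType) (I : ideal R).

Definition coherent : {pred prod_ring (fun n => quot_ring (ideal_pow I n))} :=
  fun f => `[< forall n x, f n.+1 = quot_pi _ x -> f n = quot_pi _ x >].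

Lemma ideal_powS n : ideal_pow I n.+1 `<=` ideal_pow I n.
Proof.
by move=> z; apply=> _ [x [y [_ Iy ->]]]; exact: ideal_M.
Qed.

Lemma coherentP f : reflect
  (forall n, exists2 x, f n.+1 = quot_pi _ x & f n = quot_pi _ x)
  (f \in coherent).
Proof.
apply: (iffP idP) => [/asboolP cf n|cf].
  by have [x fx] := quot_pi_surj (f n.+1); exists x => //; exact: cf.
apply/asboolP => n x fx; have [y fy ->] := cf n.
have xy : ideal_pow I n.+1 (y - x) by apply/quot_pi_eq; rewrite -fy.
by apply/quot_pi_eq; exact: (ideal_powS xy).
Qed.

Fact coherent_subring_closed : subring_closed coherent.
Proof.
split=> [|f g /coherentP cf /coherentP cg|f g /coherentP cf /coherentP cg];
  apply/coherentP => n; first by exists 1.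
- have [x fx fx'] := cf n; have [y gy gy'] := cg n.
  exists (x - y); rewrite rmorphB.
    exact: (congr2 (fun a b => a - b) fx gy).
  exact: (congr2 (fun a b => a - b) fx' gy').
- have [x fx fx'] := cf n; have [y gy gy'] := cg n.
  exists (x * y); rewrite rmorphM.
    exact: (congr2 (fun a b => a * b) fx gy).
  exact: (congr2 (fun a b => a * b) fx' gy').
Qed.

(* The I-adic completion: the inverse limit of the rings R / I^n, realized as
   the subring of coherent sequences in their product. *)
Record completion : Type := Completion {
  completion_val :> prod_ring (fun n => quot_ring (ideal_pow I n));
  _ : completion_val \in coherent }.
HB.instance Definition _ := [isSub for completion_val].
HB.instance Definition _ := [Choice of completion by <:].
HB.instance Definition _ :=
  GRing.SubChoice_isSubComPzRing.Build _ _ completion coherent_subring_closed.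

End Completion.

Section Koszul.
Variables (R : comPzRingType) (n : nat) (x : 'I_n -> R).

(* The Koszul complex K(x) is the exterior algebra on R^n; an element is given
   by its coordinates on the basis e_S = e_(i_1) /\ ... /\ e_(i_p), where
   S = {i_1 < ... < i_p}.  The differential sends e_S to the sum over j \in S
   of (-1)^(number of k \in S with k < j) x_j e_(S :\ j). *)
Definition koszul_chain (i : nat) (f : {ffun {set 'I_n} -> R}) : Prop :=
  forall S : {set 'I_n}, #|S| != i -> f S = 0.

Definition koszul_d (f : {ffun {set 'I_n} -> R}) : {ffun {set 'I_n} -> R} :=
  [ffun S : {set 'I_n} => \sum_(j | j \notin S)
     (-1) ^+ #|[pred k in S | (k < j)%N]| * x j * f (j |: S)%SET].

(* H_i(x; R) <> 0: some i-cycle is not a boundary. *)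
Definition koszul_homology_neq0 (i : nat) : Prop :=
  exists z, [/\ koszul_chain i z, koszul_d z = 0 &
    ~ exists y, koszul_chain i.+1 y /\ koszul_d y = z].

End Koszul.

Section Invariants.
Variables (R : comPzRingType) (M : ideal R).

Definition prime_chain (d : nat) : Prop :=
  exists P : nat -> ideal R,
    (forall i, (i <= d)%N -> prime_ideal (P i)) /\
    (forall i, (i < d)%N -> P i `<` P i.+1).

Definition krull_dim : nat -> Prop := is_greatest prime_chain.

(* In the following M is meant to be the maximal ideal of the local ring R. *)
Definition embedding_dim : nat -> Prop := is_least (generated_by M).

Definition depth (d : nat) : Prop :=
  exists n (x : 'I_n -> R) h,
    [/\ M = ideal_gen (range x),
        is_greatest (koszul_homology_neq0 x) h & d = (n - h)%N].

Definition geometric_dim : nat -> Prop :=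
  is_least (fun d => exists x : 'I_d -> R,
    range x `<=` M /\ artinian (quot_ring (ideal_gen (range x)))).

Definition pi_dim : nat -> Prop :=
  is_least (fun d => exists J : ideal R,
    generated_by J d /\ minimal_associated_prime J M).

End Invariants.

Section Regularity.
Variable R : comPzRingType.

Definition noetherian_local : Prop :=
  noetherian R /\ exists M : ideal R, local_ring M.

Definition embedding_dim_le (m : nat) : Prop :=
  exists M : ideal R, local_ring M /\ exists2 d, embedding_dim M d & (d <= m)%N.

Definition regular_local : Prop :=
  noetherian R /\ exists M : ideal R,
    local_ring M /\ exists d, krull_dim R d /\ embedding_dim M d.

Definition pseudo_regular : Prop :=
  exists M : ideal R, local_ring M /\ exists d, depth M d /\ embedding_dim M d.

Definition isodimensional : Prop :=
  exists M : ideal R, local_ring M /\ exists d, geometric_dim M d /\ pi_dim M d.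

End Regularity.

Definition cata_regular (R : comPzRingType) : Prop :=
  exists M : ideal R, local_ring M /\ regular_local (completion M).

Definition ultra_regular (W : Type) (F : set_system W)
    (A : W -> comPzRingType) : Prop :=
  F [set w | regular_local (A w)].

Definition countably_incomplete (W : Type) (F : set_system W) : Prop :=
  exists B : nat -> set W, (forall n, F (B n)) /\ ~ F (\bigcap_n B n).

Definition non_principal (W : Type) (F : set_system W) : Prop :=
  forall w, F <> principal_filter w.

(* Main.v *)
(* For a Noetherian local ring (A, M) write ht(I) >= d when M is not minimal over
   any I + (y_1, ..., y_e) with e < d; by Krull's height theorem and prime
   avoidance this says that A / I has a chain of d + 1 primes ending at M / I.  If
   in addition M is generated by d elements, then these form a regular sequence
   and their Koszul complex is acyclic in positive degrees; conversely, vanishing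
   of the Koszul homology above degree n - d yields a chain of length d.  Since
   acyclicity of the Koszul complex passes through the ultraproduct in both
   directions, pseudo-regularity is equivalent to ultra-regularity.

   By countable saturation the completion S of the ultraproduct R is a quotient of
   R in which finitely generated ideals are closed, hence S is Noetherian.  A
   system of parameters of S lifts to R and so to almost all factors A_w, whence
   dim S >= dim A_w, with equality in the regular case.  The geometric dimension
   of R is at least dim S.  If almost all A_w had dimension e < d = dim S, systems
   of parameters y_w would make M_w = (y_w : b_w), hence M = (y : b) a minimal
   associated prime of an ideal with e generators, and the pi-dimension would drop
   below the geometric dimension. *)
Require Import Defs.
From HB Require Import structures.
From mathcomp Require Import all_boot all_order all_algebra ring ring_quotient.
From mathcomp Require Import all_classical.

Set Implicit Arguments.
Unset Strict Implicit.
Unset Printing Implicit Defensive.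

Import GRing.Theory.

Local Open Scope classical_set_scope.
Local Open Scope ring_scope.

(** * Ideals generated by finitely many elements, powers, and Nakayama's lemma *)

(** The obstacle is that the ultraproduct need not be Noetherian, and that only statements about a
    fixed finite number of elements pass between it and its factors. The bound on embedding
    dimensions supplies such numbers: with $m$ generators for almost every $M_w$, an element of $M_w
    J_w$ is a sum of $m$ terms, so powers of the maximal ideal commute with the ultraproduct.
    Dimensions and Koszul degrees range over a finite set, so a single value holds almost
    everywhere. Height theory is applied only to the factors and to the completion.

    The height theory avoids quotients and localizations: ideals containing $I$ replace $R/I$, and
    the saturation [sat] replaces the localization at a prime.

    Conditions (2) and (3) each provide an integer $d$ such that the maximal ideal of the
    ultraproduct has $d$ generators and almost all $M_w$ have height at least $d$. The conclusions
    (3) and (1) are then drawn from this pair alone. *)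

Section IdealOperations.
Variable R : comPzRingType.
Implicit Types (I J L N P Q : ideal R) (x y z : R) (s : seq R).

Lemma ideal_ext I J : I `<=` J -> J `<=` I -> I = J.
Proof. by move=> IJ JI; apply/ideal_eqP/seteqP. Qed.

Lemma ideal_Mr I a x : I x -> I (x * a).
Proof. by rewrite mulrC; exact: ideal_M. Qed.

Lemma ideal_N I x : I x -> I (- x).
Proof. by rewrite -mulN1r; exact: ideal_M. Qed.

Lemma ideal_B I x y : I x -> I y -> I (x - y).
Proof. by move=> Ix Iy; apply: ideal_D => //; exact: ideal_N. Qed.

Lemma ideal_Dl I x y : I x -> I (x + y) -> I y.
Proof. by move=> Ix Ixy; rewrite -[y](addKr x) addrC; exact: ideal_B. Qed.

Lemma ideal_sum I (T : finType) (p : pred T) (f : T -> R) :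
  (forall i, p i -> I (f i)) -> I (\sum_(i | p i) f i).
Proof.
move=> If; elim/big_rec: _ => [|i x pi Ix]; first exact: ideal_0.
by apply: ideal_D => //; exact: If.
Qed.

Lemma ideal_full I x : I 1 -> I x.
Proof. by rewrite -[x]mulr1; exact: ideal_M. Qed.

Definition zero_ideal : ideal R.
Proof.
exists [set 0] => //= [x y -> ->|a x ->]; [exact: addr0|exact: mulr0].
Defined.

(** This is $I + (x)$, described by elements instead of as an intersection, so that membership
    yields a coefficient. Together with [adjs] it expresses ideals of a quotient by [I] inside [R]
    itself. *)
Definition adj I x : ideal R.
Proof.
exists [set z | exists a r, I a /\ z = a + r * x].
- by exists 0, 0; split; [exact: ideal_0|rewrite mul0r addr0].
- move=> _ _ [a [r [Ia ->]]] [b [t [Ib ->]]].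
  by exists (a + b), (r + t); split; [exact: ideal_D|ring].
- move=> c _ [a [r [Ia ->]]].
  by exists (c * a), (c * r); split; [exact: ideal_M|ring].
Defined.

Definition adjs I s : ideal R := foldr (fun x J => adj J x) I s.

Definition ideal_add I J : ideal R.
Proof.
exists [set z | exists a b, [/\ I a, J b & z = a + b]].
- by exists 0, 0; split; [exact: ideal_0|exact: ideal_0|rewrite addr0].
- move=> _ _ [a [b [Ia Jb ->]]] [c [e [Ic Je ->]]].
  exists (a + c), (b + e).
  by split; [exact: ideal_D|exact: ideal_D|rewrite addrACA].
- move=> c _ [a [b [Ia Jb ->]]]; exists (c * a), (c * b).
  by split; [exact: ideal_M|exact: ideal_M|rewrite mulrDr].
Defined.

Lemma adj_sub I x J : I `<=` J -> J x -> adj I x `<=` J.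
Proof.
by move=> IJ Jx _ [a [r [Ia ->]]]; apply: ideal_D; [exact: IJ|exact: ideal_M].
Qed.

Lemma sub_adj I x : I `<=` adj I x.
Proof. by move=> a Ia; exists a, 0; split=> //; rewrite mul0r addr0. Qed.

Lemma adj_in I x : adj I x x.
Proof. by exists 0, 1; split; [exact: ideal_0|rewrite mul1r add0r]. Qed.

Lemma adjs_sub I s J : I `<=` J -> (forall x, x \in s -> J x) ->
  adjs I s `<=` J.
Proof.
move=> IJ; elim: s => //= x s IH sJ; apply: adj_sub.
  by apply: IH => y ys; apply: sJ; rewrite inE ys orbT.
by apply: sJ; rewrite inE eqxx.
Qed.

Lemma sub_adjs I s : I `<=` adjs I s.
Proof. by elim: s => //= x s IH y /IH; exact: sub_adj. Qed.

Lemma adjs_in I s x : x \in s -> adjs I s x.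
Proof.
elim: s => //= y s IH; rewrite inE => /orP[/eqP->|/IH]; first exact: adj_in.
exact: sub_adj.
Qed.

Lemma adjs_le I J s : I `<=` J -> adjs I s `<=` adjs J s.
Proof.
move=> IJ; apply: adjs_sub => [x /IJ|x]; [exact: sub_adjs|exact: adjs_in].
Qed.

Lemma adjs_cat I s t : adjs I (s ++ t) = adjs (adjs I t) s.
Proof. by rewrite /adjs foldr_cat. Qed.

Lemma adjs_adj I s x : adjs (adj I x) s = adj (adjs I s) x.
Proof.
apply: ideal_ext.
  apply: adjs_sub => [|y ys]; last by apply: sub_adj; exact: adjs_in.
  apply: adj_sub; last exact: adj_in.
  by move=> y Iy; apply: sub_adj; exact: sub_adjs.
apply: adj_sub; last by apply: sub_adjs; exact: adj_in.
by apply: adjs_le; exact: sub_adj.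
Qed.

Lemma adj_le I J x : I `<=` J -> adj I x `<=` adj J x.
Proof. exact: (@adjs_le I J [:: x]). Qed.

Lemma zero_sub I : zero_ideal `<=` I.
Proof. by move=> _ ->; exact: ideal_0. Qed.

Lemma sub_add_l I J : I `<=` ideal_add I J.
Proof. by move=> x Ix; exists x, 0; split=> //; [exact: ideal_0|rewrite addr0]. Qed.

Lemma sub_add_r I J : J `<=` ideal_add I J.
Proof. by move=> x Ix; exists 0, x; split=> //; [exact: ideal_0|rewrite add0r]. Qed.

Lemma add_sub I J L : I `<=` L -> J `<=` L -> ideal_add I J `<=` L.
Proof. by move=> IL JL _ [a [b [/IL ? /JL ? ->]]]; exact: ideal_D. Qed.

Lemma gen_sub (A : set R) J : A `<=` J -> ideal_gen A `<=` J.
Proof. by move=> AJ z; apply. Qed.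

Lemma sub_gen (A : set R) : A `<=` ideal_gen A.
Proof. by move=> x Ax J; apply. Qed.

Lemma mul_in I J x y : I x -> J y -> ideal_mul I J (x * y).
Proof. by move=> Ix Jy; apply: sub_gen; exists x, y. Qed.

Lemma mul_sub I J L : (forall x y, I x -> J y -> L (x * y)) ->
  ideal_mul I J `<=` L.
Proof. by move=> IJL; apply: gen_sub => _ [x [y [Ix Jy ->]]]; exact: IJL. Qed.

Lemma gen_rangeE n (x : 'I_n -> R) :
  ideal_gen (range x) = adjs zero_ideal [seq x i | i <- enum 'I_n].
Proof.
apply: ideal_ext.
  by apply: gen_sub => _ [i _ <-]; apply: adjs_in; rewrite map_f ?mem_enum.
apply: adjs_sub; first exact: zero_sub.
by move=> _ /mapP[i _ ->]; apply: sub_gen; exists i.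
Qed.

Lemma generated_byP I n :
  generated_by I n <-> exists2 s, size s = n & I = adjs zero_ideal s.
Proof.
split=> [[x ->]|[s <- ->]].
  exists [seq x i | i <- enum 'I_n]; first by rewrite size_map size_enum_ord.
  exact: gen_rangeE.
exists (fun i => s`_i); rewrite gen_rangeE; congr adjs.
apply: (@eq_from_nth _ 0) => [|i si]; first by rewrite size_map size_enum_ord.
by rewrite (nth_map (Ordinal si)) ?size_enum_ord // nth_enum_ord.
Qed.

Definition lincomb n (x : 'I_n -> R) : ideal R.
Proof.
exists [set z | exists a : 'I_n -> R, z = \sum_i a i * x i].
- by exists (fun=> 0); rewrite big1 // => i _; rewrite mul0r.
- move=> _ _ [a ->] [b ->]; exists (fun i => a i + b i).
  by rewrite -big_split; apply: eq_bigr => i _; rewrite mulrDl.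
- move=> c _ [a ->]; exists (fun i => c * a i).
  by rewrite mulr_sumr; apply: eq_bigr => i _; rewrite mulrA.
Defined.

Lemma gen_rangeP n (x : 'I_n -> R) z :
  ideal_gen (range x) z <-> exists a : 'I_n -> R, z = \sum_i a i * x i.
Proof.
split; last first.
  move=> [a ->]; apply: (@ideal_sum (ideal_gen (range x))) => i _; apply: ideal_M.
  by apply: sub_gen; exists i.
apply: (@gen_sub _ (lincomb x)) => _ [i _ <-]; exists (fun j => (j == i)%:R).
rewrite (bigD1 i) //= eqxx mul1r big1 ?addr0 // => j /negbTE->.
by rewrite mul0r.
Qed.

(** Here the coefficients lie in [J], and their number is that of the generators. This uniform
    length is what lets products of ideals commute with ultraproducts. *)
Definition lincomb_in n (x : 'I_n -> R) J : ideal R.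
Proof.
exists [set z | exists2 b : 'I_n -> R, (forall i, J (b i)) & z = \sum_i x i * b i].
- exists (fun=> 0) => [i|]; first exact: ideal_0.
  by rewrite big1 // => i _; rewrite mulr0.
- move=> _ _ [a Ja ->] [b Jb ->]; exists (fun i => a i + b i) => [i|].
    by apply: ideal_D; [exact: Ja|exact: Jb].
  by rewrite -big_split; apply: eq_bigr => i _; rewrite mulrDr.
- move=> c _ [a Ja ->]; exists (fun i => c * a i) => [i|].
    by apply: ideal_M; exact: Ja.
  by rewrite mulr_sumr; apply: eq_bigr => i _; rewrite mulrCA.
Defined.

Lemma mul_gen_range n (x : 'I_n -> R) J :
  ideal_mul (ideal_gen (range x)) J `<=` lincomb_in x J.
Proof.
apply: mul_sub => _ y /gen_rangeP[a ->] Jy.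
exists (fun i => a i * y) => [i|]; first exact: ideal_M.
by rewrite mulr_suml; apply: eq_bigr => i _; rewrite mulrCA mulrA.
Qed.

(* Membership of [I ^ n] in [J] is tested on products of [n] elements of [I],
   which is a statement that passes through ring morphisms and ultraproducts. *)
Lemma pow_prod I n (u : 'I_n -> R) : (forall j, I (u j)) ->
  ideal_pow I n (\prod_j u j).
Proof.
elim: n u => [//|N IH] u Iu; rewrite big_ord_recl.
by apply: mul_in; [exact: Iu|apply: IH => j; exact: Iu].
Qed.

Lemma pow_sub I n J :
  (forall u : 'I_n -> R, (forall j, I (u j)) -> J (\prod_j u j)) ->
  ideal_pow I n `<=` J.
Proof.
elim: n J => [|n IH] J JI.
  by move=> z _; apply: ideal_full; have := JI (fun=> 0); rewrite big_ord0; apply; case.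
(* One factor is removed by replacing [J] with $(J : x)$. *)
apply: mul_sub => x y Ix; rewrite mulrC; apply: (IH (ideal_colon J x)).
move=> u Iu; pose v i := if unlift ord0 i is Some j then u j else x.
have -> : ideal_colon J x (\prod_j u j) = J (\prod_j v j).
  rewrite big_ord_recl /v unlift_none mulrC; congr (J (_ * _)).
  by apply: eq_bigr => j _; rewrite liftK.
by apply: JI => j; rewrite /v; case: unlift.
Qed.

Lemma pow_exp I n x : I x -> ideal_pow I n (x ^+ n).
Proof.
by move=> Ix; have := @pow_prod I n (fun=> x); rewrite prodr_const card_ord; apply.
Qed.

Lemma pow_le I m n : (m <= n)%N -> ideal_pow I n `<=` ideal_pow I m.
Proof.
move=> /subnK <-; elim: (n - m)%N => // k IH; rewrite addSn.
by move=> z /ideal_powS/IH.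
Qed.

Lemma pow1 I : ideal_pow I 1 = I.
Proof.
apply: ideal_ext; first by apply: mul_sub => x y Ix _; exact: ideal_Mr.
move=> x Ix; rewrite -[x]mulr1; exact: (@mul_in I (@unit_ideal R)).
Qed.

Definition fg I := exists s, I = adjs zero_ideal s.

Lemma fg_adjs I s : fg I -> fg (adjs I s).
Proof. by move=> [t ->]; exists (s ++ t); rewrite adjs_cat. Qed.

Lemma fg_adj I x : fg I -> fg (adj I x).
Proof. exact: (@fg_adjs I [:: x]). Qed.

Lemma fg_mul I J : fg I -> fg J -> fg (ideal_mul I J).
Proof.
move=> [s ->] [t ->]; exists [seq x * y | x <- s, y <- t]; apply: ideal_ext.
  apply: mul_sub => x y; set L := adjs _ [seq _ | _ <- _, _ <- _] => sx.
  rewrite mulrC; apply: (@adjs_sub _ _ (ideal_colon L x)); first exact: zero_sub.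
  move=> z zt; rewrite /ideal_has /= mulrC.
  apply: (@adjs_sub _ _ (ideal_colon L z) _ _ x sx); first exact: zero_sub.
  by move=> w ws; apply: adjs_in; apply/allpairsP; exists (w, z).
apply: adjs_sub; first exact: zero_sub.
by move=> _ /allpairsP[[x y] [/= xs yt ->]]; apply: mul_in; exact: adjs_in.
Qed.

Lemma fg_pow I n : fg I -> fg (ideal_pow I n).
Proof.
move=> fI; elim: n => [|n IH]; last exact: fg_mul.
exists [:: 1]; apply: ideal_ext => // x _.
by apply: (@ideal_full (adj _ 1)); exact: adj_in.
Qed.

Lemma noetherian_fg I : noetherian R -> fg I.
Proof. by move=> /(_ I)[n /generated_byP[s _ ->]]; exists s. Qed.

Lemma fg_noetherian : (forall I, fg I) -> noetherian R.
Proof.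
by move=> fR I; have [s ->] := fR I; exists (size s); apply/generated_byP; exists s.
Qed.

(* The preimage in [R] of the extension of [I] to the localization at [P]. *)
Definition sat P (PP : prime_ideal P) I : ideal R.
Proof.
exists [set z | exists t, ~ P t /\ I (t * z)].
- by exists 1; split; [case: PP|rewrite mulr0; exact: ideal_0].
- move=> x y [t [nt It]] [u [nu Iu]]; exists (t * u); split.
    by case: PP => _ PM /PM[].
  rewrite mulrDr; apply: ideal_D; last by rewrite -mulrA; apply: ideal_M.
  by rewrite mulrAC; exact: ideal_Mr.
- move=> a x [t [nt It]]; exists t; split=> //.
  by rewrite mulrCA; exact: ideal_M.
Defined.

Lemma prime_mul P x y : prime_ideal P -> ~ P x -> ~ P y -> ~ P (x * y).
Proof. by move=> [_ PM] nx ny /PM[]. Qed.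

Lemma prime_exp P x n : prime_ideal P -> P (x ^+ n) -> P x.
Proof.
move=> PP; elim: n => [|n IH]; first by rewrite expr0 => /(proj1 PP).
by rewrite exprS => /(proj2 PP)[].
Qed.

Lemma sub_sat P (PP : prime_ideal P) I : I `<=` sat PP I.
Proof. by move=> x Ix; exists 1; rewrite mul1r; split=> //; case: PP. Qed.

Lemma sat_le P (PP : prime_ideal P) I J : I `<=` J -> sat PP I `<=` sat PP J.
Proof. by move=> IJ z [t [nt /IJ ?]]; exists t. Qed.

Lemma sat_sat P (PP : prime_ideal P) I : sat PP (sat PP I) `<=` sat PP I.
Proof.
move=> z [t [nt [u [nu]]]]; rewrite mulrA => It.
by exists (u * t); split=> //; exact: prime_mul.
Qed.

Lemma sat_prime P (PP : prime_ideal P) Q :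
  prime_ideal Q -> Q `<=` P -> sat PP Q `<=` Q.
Proof. by move=> [_ QM] QP z [t [nt /QM[/QP|]]]. Qed.

Definition ideal_scale P x : ideal R.
Proof.
exists [set z | exists2 p, P p & z = p * x].
- by exists 0; [exact: ideal_0|rewrite mul0r].
- by move=> _ _ [a ? ->] [b ? ->]; exists (a + b); [exact: ideal_D|rewrite mulrDl].
- by move=> a _ [p Pp ->]; exists (a * p); [exact: ideal_M|rewrite mulrA].
Defined.

(** Nakayama's lemma localized at [P], by induction on the generators instead of a determinant:
    modulo $L + (x)$ the other generators vanish, and then $(1 - p) x \in L$ locally for some $p \in
    P$. *)
Lemma nakayama P (PP : prime_ideal P) L s :
  (forall z, z \in s -> sat PP (ideal_add L (ideal_mul P (adjs zero_ideal s))) z) ->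
  adjs zero_ideal s `<=` sat PP L.
Proof.
elim: s L => [|x s IH] L; first by move=> _; exact: zero_sub.
move=> sL.
have sLx : adjs zero_ideal s `<=` sat PP (adj L x).
  apply: IH => z zs; have : z \in x :: s by rewrite inE zs orbT.
  move=> /sL; apply: sat_le; apply: add_sub.
    by move=> y Ly; apply: sub_add_l; exact: sub_adj.
  apply: mul_sub => p _ Pp [a [r [sa ->]]]; rewrite mulrDr; apply: ideal_D.
    by apply: sub_add_r; exact: mul_in.
  by apply: sub_add_l; apply: ideal_M; apply: ideal_M; exact: adj_in.
pose T : ideal R := sat PP (ideal_add L (ideal_mul P (adj zero_ideal x))).
have PT : ideal_mul P (adjs zero_ideal (x :: s)) `<=` T.
  apply: mul_sub => p _ Pp [a [r [/sLx[t [nt [l [q [Ll e]]]]] ->]]].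
  exists t; split=> //; exists (p * l), (p * ((q + t * r) * x)); split.
  - exact: ideal_M.
  - by apply: mul_in => //; apply: ideal_M; exact: adj_in.
  - by rewrite mulrCA mulrDr e; ring.
have [t [nt [l [m [Ll /PT[u [nu [l' [q [Ll' qP e']]]]] e]]]]] := sL x (mem_head _ _).
have [p Pp eq] : ideal_scale P x q.
  move: q qP {e'}; apply: mul_sub => p _ Pp [_ [r [-> ->]]].
  by exists (p * r); [exact: ideal_Mr|ring].
have Lx : sat PP L x.
  (* Clearing denominators gives $utx - px \in L$, and $ut - p$ avoids [P] because $ut$ does. *)
  exists (u * t - p); split.
    move=> Put; apply: (prime_mul PP nu nt).
    by rewrite -[u * t](subrK p); exact: ideal_D.
  rewrite mulrBl -eq -mulrA e mulrDr e' addrA addrK.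
  by apply: ideal_D => //; exact: ideal_M.
apply: adjs_sub; first exact: zero_sub.
move=> z; rewrite inE => /predU1P[->//|zs].
apply: sat_sat; have := sLx z (adjs_in _ zs); apply: sat_le.
by apply: adj_sub => //; exact: sub_sat.
Qed.

Lemma nakayama_ideal P (PP : prime_ideal P) L N : fg N ->
  N `<=` sat PP (ideal_add L (ideal_mul P N)) -> N `<=` sat PP L.
Proof.
by move=> [s ->] h; apply: nakayama => z zs; apply: h; exact: adjs_in.
Qed.

End IdealOperations.

(** * Local rings, the height theorem and dimension *)

(** Classical equality gives lists of ideals, such as lists of primes, a membership test [\in]. *)
HB.instance Definition _ (R : comPzRingType) := gen_eqMixin (ideal R).

(** Locality as invertibility outside [M]: this form passes to the ultraproduct element by
    element. *)
Definition local_at (R : comPzRingType) (M : ideal R) :=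
  ~ M 1 /\ forall a, ~ M a -> exists b, b * a = 1.

Definition minimal_over (R : comPzRingType) (I P : ideal R) :=
  [/\ prime_ideal P, I `<=` P &
      forall Q, prime_ideal Q -> I `<=` Q -> Q `<=` P -> P `<=` Q].

Section LocalRings.
Variable R : comPzRingType.
Implicit Types (I J M : ideal R) (x : R).

Lemma local_at_prime M : local_at M -> prime_ideal M.
Proof.
move=> [nM uM]; split=> // x y Mxy.
apply: contrapT => /not_orP[/uM[a ax] /uM[b by1]]; apply: nM.
rewrite -[1]mulr1 -{1}ax -by1 (_ : _ * _ = a * b * (x * y)); last by ring.
exact: ideal_M.
Qed.

Lemma local_at_sub M J : local_at M -> ~ J 1 -> J `<=` M.
Proof.
move=> [_ uM] nJ x Jx; apply: contrapT => /uM[b bx]; apply: nJ.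
by rewrite -bx; exact: ideal_M.
Qed.

Lemma local_at_ring M : local_at M -> local_ring M.
Proof.
move=> lM; have [nM uM] := lM.
have maxM : maximal_ideal M.
  by split=> // J _ nJ; exact: local_at_sub.
split=> // J [nJ mJ]; have JM := local_at_sub lM nJ.
by apply: ideal_ext => //; exact: mJ.
Qed.

Lemma local_at_sat M (PM : prime_ideal M) I : local_at M -> sat PM I `<=` I.
Proof.
move=> [_ uM] z [t [/uM[b bt] Itz]].
by rewrite -[z]mul1r -bt -mulrA; exact: ideal_M.
Qed.

Lemma nakayama_local M L N : local_at M -> fg N ->
  N `<=` ideal_add L (ideal_mul M N) -> N `<=` L.
Proof.
move=> lM fN NL; have PM := local_at_prime lM.
suff: N `<=` sat PM L by move=> h z /h; exact: local_at_sat.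
by apply: nakayama_ideal => // z /NL; exact: sub_sat.
Qed.

End LocalRings.

(** * Primes in Noetherian rings: avoidance, the principal ideal theorem and heights *)

Section Noetherian.
Variable R : comPzRingType.
Hypothesis nR : noetherian R.
Implicit Types (I J N P Q M : ideal R) (x y z : R) (s : seq R).

Lemma ascending_le (c : nat -> ideal R) : (forall n, c n `<=` c n.+1) ->
  forall m n, (m <= n)%N -> c m `<=` c n.
Proof.
by move=> cS m n /subnK <-; elim: (n - m)%N => // k IH z /IH; exact: cS.
Qed.

Definition ideal_union (c : nat -> ideal R) (cS : forall n, c n `<=` c n.+1) :
  ideal R.
Proof.
exists [set z | exists n, c n z].
- by exists 0%N; exact: ideal_0.
- move=> x y [m cx] [n cy]; exists (maxn m n); apply: ideal_D.
    by apply: (ascending_le cS (m := m)); rewrite ?leq_maxl.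
  by apply: (ascending_le cS (m := n)); rewrite ?leq_maxr.
- by move=> a x [n cx]; exists n; exact: ideal_M.
Defined.

(** Otherwise choice yields a strictly ascending sequence, and the finitely many generators of its
    union already lie in one of its terms. *)
Lemma noetherian_maximal (X : ideal R -> Prop) : (exists I, X I) ->
  exists I, X I /\ forall J, X J -> I `<=` J -> J `<=` I.
Proof.
move=> [I0 X0]; apply: contrapT => nmax.
have step (u : {I | X I}) : exists v : {I | X I}, sval u `<` sval v.
  apply: contrapT => nv; apply: nmax; exists (sval u); split; first exact: svalP.
  move=> J XJ uJ; apply: contrapT => nJ; apply: nv.
  by exists (exist _ J XJ).
have [f fP] := choice step.
pose c n := sval (iter n f (exist _ I0 X0)).
have cS n : c n `<=` c n.+1 by case: (fP (iter n f (exist _ I0 X0))).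
have [s Es] := noetherian_fg (ideal_union cS) nR.
have [n sn] : exists n, forall x, x \in s -> c n x.
  have: forall x, x \in s -> ideal_union cS x by move=> x; rewrite Es; exact: adjs_in.
  elim: (s) => [|y t IH] tU; first by exists 0%N.
  have [|m tm] := IH; first by move=> x xt; apply: tU; rewrite inE xt orbT.
  have [k yk] := tU y (mem_head _ _).
  exists (maxn m k) => x; rewrite inE => /predU1P[->|/tm].
    by apply: (ascending_le cS) yk; rewrite leq_maxr.
  by apply: (ascending_le cS); rewrite leq_maxl.
have [_] := fP (iter n f (exist _ I0 X0)); apply.
move=> z cz; have : ideal_union cS z by exists n.+1.
by rewrite Es; apply: adjs_sub => //; exact: zero_sub.
Qed.

Lemma noetherian_ind (X : ideal R -> Prop) :
  (forall I, (forall J, I `<` J -> X J) -> X I) -> forall I, X I.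
Proof.
move=> XI I; apply: contrapT => nI.
have [J [nJ Jmax]] := @noetherian_maximal (fun I => ~ X I) (ex_intro _ I nI).
apply: nJ; apply: XI => K [JK nKJ]; apply: contrapT => nK.
by apply: nKJ; exact: Jmax.
Qed.

(** An ideal maximal among those containing [I] and missing a multiplicative set is prime. *)
Lemma prime_avoiding I (S : set R) : S 1 -> (forall x y, S x -> S y -> S (x * y)) ->
  (forall x, I x -> ~ S x) ->
  exists P, [/\ prime_ideal P, I `<=` P & forall x, P x -> ~ S x].
Proof.
move=> S1 SM IS.
have [|P [[IP PS] Pmax]] :=
  @noetherian_maximal (fun J => I `<=` J /\ forall x, J x -> ~ S x).
  by exists I; split.
have meet u : ~ P u -> exists2 z, adj P u z & S z.
  move=> nu; apply: contrapT => nz; apply: nu; apply: Pmax (adj_in P u).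
    split=> [z /IP|z uz Sz]; first exact: sub_adj.
    by apply: nz; exists z.
  exact: sub_adj.
exists P; split=> //; split; first by move=> P1; exact: (PS 1).
move=> u v Puv; apply: contrapT => /not_orP[/meet[_ [a [r [Pa ->]]] Sa]].
move=> /meet[_ [b [t [Pb ->]]] Sb]; apply: PS (SM _ _ Sa Sb).
rewrite mulrDl; apply: ideal_D; first exact: ideal_Mr.
rewrite mulrDr; apply: ideal_D; first exact: ideal_M.
by rewrite mulrACA; exact: ideal_M.
Qed.

Lemma local_ring_at M : local_ring M -> local_at M.
Proof.
move=> [[nM _] uM]; split=> // a nMa; apply: contrapT => na.
have [|J [[aJ nJ] Jmax]] :=
  @noetherian_maximal (fun J => adj (zero_ideal R) a `<=` J /\ ~ J 1).
  exists (adj (zero_ideal R) a); split=> // -[_ [b [-> e]]]; apply: na.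
  by exists b; rewrite e add0r.
have JM : J = M.
  apply: uM; split=> // K JK nK; apply: Jmax => //; split=> //.
  by move=> z /aJ/JK.
by apply: nMa; rewrite -JM; apply: aJ; exact: adj_in.
Qed.

(** Take $(J:b)$ maximal among the colons contained in [P]. If $uv \in (J:b)$ but neither factor is,
    then $(J:ub)$ is larger, so some $s \notin P$ has $sub \in J$; now $(J:sb)$ still lies in [P]
    and contains [u], a contradiction. *)
Lemma associated_prime_below J P : prime_ideal P -> J `<=` P ->
  exists b, [/\ prime_ideal (ideal_colon J b), J `<=` ideal_colon J b &
                ideal_colon J b `<=` P].
Proof.
move=> PP JP.
have [|_ [[b -> bP] bmax]] := @noetherian_maximal
  (fun I => exists2 b, I = ideal_colon J b & ideal_colon J b `<=` P).
  by exists (ideal_colon J 1), 1 => // z; rewrite /ideal_colon /= mulr1 => /JP.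
exists b; split=> //; last by move=> x Jx; exact: ideal_Mr.
split=> [b1|u v buv]; first by case: PP => /(_ (bP _ b1)).
apply: contrapT => /not_orP[nu nv]; apply: (nu).
have [s Psb nPs] : exists2 s, ideal_colon J (u * b) s & ~ P s.
  apply: contrapT => ns; apply: nv; apply: (bmax (ideal_colon J (u * b))).
  - exists (u * b) => // s us; apply: contrapT => nPs; apply: ns.
    by exists s.
  - by move=> r Jr; rewrite /ideal_colon /= mulrCA; exact: ideal_M.
  - by rewrite /ideal_has /= mulrA [v * u]mulrC.
apply: (bmax (ideal_colon J (s * b))).
- exists (s * b) => // r; rewrite /ideal_colon /= mulrA => /bP Prs.
  by case: PP => _ /(_ _ _ Prs)[].
- by move=> r Jr; rewrite /ideal_colon /= mulrCA; exact: ideal_M.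
- by rewrite /ideal_has /= mulrCA.
Qed.

(** If $uv \in I$ with $u, v \notin I$, every prime over [I] contains $I + (u)$ or $I + (v)$, and
    the two lists are joined. The list may also contain primes that are not minimal. *)
Lemma minimal_primes I : exists Ps : seq (ideal R),
  (forall P, P \in Ps -> prime_ideal P /\ I `<=` P) /\
  (forall Q, prime_ideal Q -> I `<=` Q -> exists2 P, P \in Ps & P `<=` Q).
Proof.
elim/noetherian_ind: I => I IH.
have [PI|nPI] := pselect (prime_ideal I).
  exists [:: I]; split=> [P|Q _ IQ]; first by rewrite inE => /eqP->; split.
  by exists I; rewrite ?inE.
have [I1|nI1] := pselect (I 1).
  by exists [::]; split=> // Q [nQ _] /(_ 1 I1).
have [u [v [Iuv nu nv]]] : exists u v, [/\ I (u * v), ~ I u & ~ I v].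
  apply: contrapT => nuv; apply: nPI; split=> // u v Iuv.
  by apply: contrapT => /not_orP[nu nv]; apply: nuv; exists u, v.
have lt w : ~ I w -> I `<` adj I w.
  by move=> nw; split=> [|/(_ w (adj_in I w))//]; exact: sub_adj.
have [Us [U1 U2]] := IH _ (lt u nu); have [Vs [V1 V2]] := IH _ (lt v nv).
exists (Us ++ Vs); split=> [P|Q PQ IQ].
  rewrite mem_cat => /orP[/U1|/V1] [PP uP]; split=> // z Iz.
    by apply: uP; exact: sub_adj.
  by apply: uP; exact: sub_adj.
case: (PQ) => _ /(_ _ _ (IQ _ Iuv))[Qu|Qv].
  have [|P PU PQ'] := U2 Q PQ; first exact: adj_sub.
  by exists P; rewrite ?mem_cat ?PU.
have [|P PV PQ'] := V2 Q PQ; first exact: adj_sub.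
by exists P; rewrite ?mem_cat ?PV ?orbT.
Qed.

(** The same splitting along $uv \in J$: exponents for $J + (u)$ and $J + (v)$ add up to one for
    [J]. *)
Lemma local_pow_sub M J : local_at M ->
  (forall Q, prime_ideal Q -> J `<=` Q -> M `<=` Q) ->
  exists n, ideal_pow M n `<=` J.
Proof.
move=> lM; elim/noetherian_ind: J => J IH JM.
have [PJ|nPJ] := pselect (prime_ideal J).
  by exists 1%N; rewrite pow1; exact: JM.
have [J1|nJ1] := pselect (J 1).
  by exists 0%N => z _; exact: ideal_full.
have [u [v [Juv nu nv]]] : exists u v, [/\ J (u * v), ~ J u & ~ J v].
  apply: contrapT => nuv; apply: nPJ; split=> // u v Juv.
  by apply: contrapT => /not_orP[nu nv]; apply: nuv; exists u, v.
have lt w : ~ J w -> J `<` adj J w.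
  by move=> nw; split=> [|/(_ w (adj_in J w))//]; exact: sub_adj.
have adjM w Q : prime_ideal Q -> adj J w `<=` Q -> M `<=` Q.
  by move=> PQ wQ; apply: JM => // z Jz; apply: wQ; exact: sub_adj.
have [m Mm] := IH _ (lt u nu) (@adjM u); have [n Mn] := IH _ (lt v nv) (@adjM v).
exists (m + n)%N; apply: pow_sub => w Mw; rewrite big_split_ord /=.
have /Mm[a [r [Ja ->]]] := pow_prod (fun j => Mw (lshift n j)).
have /Mn[b [t [Jb ->]]] := pow_prod (fun j => Mw (rshift m j)).
rewrite mulrDl; apply: ideal_D; first exact: ideal_Mr.
rewrite mulrDr; apply: ideal_D; first exact: ideal_M.
by rewrite mulrACA; exact: ideal_M.
Qed.

(** If a solution for the other primes fails at [P], it is corrected by an element of [I] that lies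
    in those primes but not in [P]. *)
Lemma coset_prime_avoidance I x (Ps : seq (ideal R)) :
  (forall P, P \in Ps -> prime_ideal P /\ ~ (P x /\ I `<=` P)) ->
  exists2 y, I y & forall P, P \in Ps -> ~ P (x + y).
Proof.
have [n] := ubnP (size Ps); elim: n Ps => // n IH [|P Ps] szP hP.
  by exists 0; first exact: ideal_0.
have [PP nIP] := hP P (mem_head _ _).
(* Avoiding [P] also avoids the primes inside [P]. Each remaining prime has an element outside [P],
   as the correcting factor [t] requires. *)
pose Qs := [seq Q : ideal R <- Ps | `[< ~ Q `<=` P >]].
have QsP Q : Q \in Qs -> Q \in Ps /\ ~ Q `<=` P.
  by rewrite mem_filter => /andP[/asboolP].
have [||y Iy yQ] := IH Qs.
- by rewrite size_filter; rewrite ltnS in szP; exact: leq_ltn_trans (count_size _ _) szP.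
- by move=> Q /QsP[QPs _]; apply: hP; rewrite inE QPs orbT.
have PsQ z : ~ P z -> (forall Q, Q \in Qs -> ~ Q z) ->
    forall Q, Q \in P :: Ps -> ~ Q z.
  move=> nPz nQz Q; rewrite inE => /predU1P[->//|QPs].
  have [QP /QP//|nQP] := pselect (Q `<=` P).
  by apply: nQz; rewrite mem_filter QPs andbT; exact/asboolP.
have [Pxy|nPxy] := pselect (P (x + y)); last by exists y => //; exact: PsQ.
have /existsNP[z /not_implyP[Iz nPz]] : ~ I `<=` P.
  move=> IP; apply: nIP; split=> //.
  by apply: (ideal_Dl (IP _ Iy)); rewrite addrC.
have [t nPt Qt] : exists2 t, ~ P t & forall Q, Q \in Qs -> Q t.
  have: forall Q, Q \in Qs -> ~ Q `<=` P by move=> Q /QsP[].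
  elim: (Qs) => [|Q Ts IHT] TP; first by exists 1 => //; case: PP.
  have [|t nPt Tt] := IHT; first by move=> T TT; apply: TP; rewrite inE TT orbT.
  have /existsNP[q /not_implyP[Qq nPq]] := TP Q (mem_head _ _).
  exists (q * t); first exact: prime_mul.
  move=> T; rewrite inE => /predU1P[->|/Tt Tt']; first exact: ideal_Mr.
  exact: ideal_M.
exists (y + z * t); first by apply: ideal_D => //; exact: ideal_Mr.
rewrite addrA; apply: PsQ => [Pw|Q QQs Qw].
  by apply: (prime_mul PP nPz nPt); exact: ideal_Dl Pw.
apply: (yQ Q QQs); rewrite addrC in Qw; apply: ideal_Dl Qw.
by apply: ideal_M; exact: Qt.
Qed.

Definition ideal_cap I J : ideal R.
Proof.
exists (I `&` J); first by split; exact: ideal_0.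
- by move=> x y [Ix Jx] [Iy Jy]; split; exact: ideal_D.
- by move=> a x [Ix Jx]; split; exact: ideal_M.
Defined.

(** This replaces the fact that $(R/I_0)_P$ is Artinian. Instead of a composition series, a
    saturated ideal [N] maximal with the chain property is taken; if it were proper, it could be
    enlarged by one simple step. Only one stationary step of the chain is asserted, which is what
    the principal ideal theorem uses. *)
Lemma saturated_dcc I0 P (PP : prime_ideal P) : minimal_over I0 P ->
  forall c : nat -> ideal R, (forall n, c n.+1 `<=` c n) ->
  (forall n, I0 `<=` c n) -> (forall n, sat PP (c n) `<=` c n) ->
  exists n, c n `<=` c n.+1.
Proof.
move=> [_ I0P minP].
pose D N := forall c : nat -> ideal R, (forall n, c n.+1 `<=` c n) ->
  (forall n, I0 `<=` c n) -> (forall n, sat PP (c n) `<=` c n) ->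
  c 0%N `<=` N -> exists n, c n `<=` c n.+1.
have [|N [[I0N sN DN] Nmax]] :=
  @noetherian_maximal (fun N => [/\ I0 `<=` N, sat PP N `<=` N & D N]).
  exists (sat PP I0); split; [exact: sub_sat|exact: sat_sat|].
  move=> c cS I0c sc c0; exists 0%N => z /c0 z0; apply: sc.
  by apply: sat_le z0; exact: I0c.
have [N1 c cS I0c sc|nN1] := pselect (N 1).
  by apply: DN => // z _; exact: ideal_full.
have NP : N `<=` P.
  move=> z Nz; apply: contrapT => nPz; apply/nN1/sN.
  by exists z; rewrite mulr1.
have [b [Pb NB bP]] := associated_prime_below PP NP.
(* Minimality of [P] over [I0] gives $Pb \subseteq N$, so that locally at [P] the enlargement of [N]
   by [b] is a simple step. *)
have Pcol : P `<=` ideal_colon N b by apply: minP => // z /I0N/NB.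
pose N' := sat PP (adj N b).
exfalso; case: (Pb) => b1 _; apply: b1; rewrite /ideal_has /= mul1r.
have NN' : N `<=` N' by move=> z Nz; apply: sub_sat; exact: sub_adj.
apply: (Nmax N') => //; last by apply: sub_sat; exact: adj_in.
split; [by move=> z /I0N/NN'|exact: sat_sat|].
move=> c cS I0c sc c0.
have cdec m n : c (m + n)%N `<=` c m.
  by elim: n => [|n IH]; rewrite ?addn0 ?addnS// => z /cS/IH.
(* Either the chain eventually falls into [N], or it never does and [D N] is applied to its
   intersections with [N]. *)
have [[k ckN]|nk] := pselect (exists k, c k `<=` N).
  have [n|n|n||n cn] := DN (fun n => c (k + n)%N).
  - by rewrite addnS.
  - exact: I0c.
  - exact: sc.
  - by rewrite addn0.
  - by exists (k + n)%N; rewrite -addnS.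
have [n|n|n||n cn] := DN (fun n => ideal_cap (c n) N).
- by move=> z [cz Nz]; split=> //; exact: cS.
- by move=> z Iz; split; [exact: I0c|exact: I0N].
- move=> z [t [nt [ct Nt]]]; split; first by apply: sc; exists t.
  by apply: sN; exists t.
- by move=> z [].
exists n => a ca.
have /existsNP[a' /not_implyP[ca' nNa']] : ~ c n.+1 `<=` N.
  by move=> h; apply: nk; exists n.+1.
have [t [nt [n1 [r [Nn1 e]]]]] : N' a by apply: c0; apply: (cdec 0%N n).
have [t' [nt' [n2 [r' [Nn2 e']]]]] : N' a' by apply: c0; apply: (cdec 0%N n.+1).
have nr' : ~ P r'.
  move=> Pr'; apply/nNa'/sN; exists t'; split=> //; rewrite e'.
  by apply: ideal_D => //; exact: Pcol.
(* Up to factors outside [P], both [a] and [a'] are multiples of [b] modulo [N]. Eliminating [b]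
   leaves an element of $N \cap c_n$, which lies in $c_{n+1}$. *)
apply: sc; exists (r' * t); split; first exact: prime_mul.
have E : r' * t * a = (r' * n1 - r * n2) + r * t' * a'.
  by rewrite -!mulrA e e'; ring.
have cE : c n.+1 (r' * n1 - r * n2).
  apply: (cn _ _).1; split.
    have -> : r' * n1 - r * n2 = r' * t * a - r * t' * a' by rewrite E addrK.
    by apply: ideal_B; apply: ideal_M => //; exact: cS.
  by apply: ideal_B; exact: ideal_M.
by rewrite E; apply: ideal_D => //; exact: ideal_M.
Qed.

(* Krull's principal ideal theorem, with symbolic powers of [Q] in place of the
   powers of the maximal ideal of the localization at [Q]. *)
Lemma principal_ideal_theorem P0 Q P x : prime_ideal P0 -> prime_ideal Q ->
  P0 `<=` Q -> Q `<` P -> minimal_over (adj P0 x) P -> Q `<=` P0.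
Proof.
move=> PP0 PQ P0Q [QP nPQ] mP; have [PP xP minP] := mP.
have nQx : ~ Q x by move=> Qx; apply: nPQ; apply: minP => //; exact: adj_sub.
pose S n := sat PQ (ideal_add P0 (ideal_pow Q n)).
have SS n : S n.+1 `<=` S n.
  apply: sat_le; apply: add_sub; first exact: sub_add_l.
  by move=> z /ideal_powS; exact: sub_add_r.
have Ssat n : sat PP (S n) `<=` S n.
  move=> z [t [nt St]]; apply: sat_sat; exists t; split=> // Qt.
  by apply: nt; exact: QP.
(* The ideals $S_n + (x)$, saturated at [P], contain $P_0 + (x)$, over which [P] is minimal. *)
have [|||n Sn] := @saturated_dcc (adj P0 x) P PP mP (fun n => sat PP (adj (S n) x)).
- by move=> n; apply: sat_le; exact: adj_le.
- move=> n z h; apply: sub_sat; move: z h; apply: adj_le => z h.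
  by apply: sub_sat; exact: sub_add_l.
- by move=> n; exact: sat_sat.
(* For $z \in S_n$ write $tz = a + rx$ with $a \in S_{n+1}$. As $x \notin Q$ and $S_n$ is saturated
   at [Q], also $r \in S_n$, and Nakayama at [P] removes the term $rx$. *)
have {}Sn : S n `<=` S n.+1.
  suff h : S n `<=` sat PP (S n.+1) by move=> z /h; exact: Ssat.
  apply: nakayama_ideal; first exact: noetherian_fg.
  move=> z Sz; have [|t [nt [a [r [Sa e]]]]] := Sn z.
    by apply: sub_sat; exact: sub_adj.
  exists t; split=> //; rewrite e; exists a, (r * x); split=> //.
  rewrite mulrC; apply: mul_in; first by apply: xP; exact: adj_in.
  apply: sat_sat; exists x; split=> //.
  rewrite mulrC; apply: (@ideal_Dl _ (S n) a); first exact: SS.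
  by rewrite -e; exact: ideal_M.
(* Now Nakayama at [Q], since locally $Q^n \subseteq P_0 + Q \cdot Q^n$. *)
have QnP0 : ideal_pow Q n `<=` sat PQ P0.
  apply: nakayama_ideal; first exact: noetherian_fg.
  by move=> z Qz; apply: Sn; apply: sub_sat; exact: sub_add_r.
move=> q Qq; apply: (@prime_exp _ _ _ n PP0).
by apply: (sat_prime PP0 P0Q (PP := PQ)); apply: QnP0; exact: pow_exp.
Qed.

Inductive pchain : nat -> ideal R -> ideal R -> Prop :=
| pchain0 P : prime_ideal P -> pchain 0 P P
| pchainS k P Q Q' : pchain k P Q -> prime_ideal Q' -> Q `<` Q' ->
    pchain k.+1 P Q'.

Lemma pchain_prime k P Q : pchain k P Q -> prime_ideal Q.
Proof. by case. Qed.

Lemma pchain_primel k P Q : pchain k P Q -> prime_ideal P.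
Proof. by elim. Qed.

Lemma pchain_sub k P Q : pchain k P Q -> P `<=` Q.
Proof.
elim=> [? ? z|{}k {}P {}Q Q' _ PQ _ [QQ' _] z]; first by [].
by move=> /PQ/QQ'.
Qed.

Lemma pchain_cons k P0 P Q : prime_ideal P0 -> P0 `<` P -> pchain k P Q ->
  pchain k.+1 P0 Q.
Proof.
move=> PP0 + PQ; elim: PQ => [{}P PP P0P|{}k {}P {}Q Q' _ IH PQ' QQ' P0P].
  by apply: pchainS (pchain0 PP0) _ _.
by apply: pchainS QQ' => //; exact: IH.
Qed.

Lemma pchain_push k P0 P x : pchain k.+1 P0 P -> P x ->
  exists P1, [/\ pchain k P1 P, P0 `<=` P1 & P1 x].
Proof.
elim: k P => [|k IH] P cP Px.
  exists P; split=> //; last exact: pchain_sub cP.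
  by apply: pchain0; exact: pchain_prime cP.
inversion cP as [|k' P' Q Q' cQ PP QP]; subst.
have [Qx|nQx] := pselect (Q x).
  have [P1 [cP1 P01 P1x]] := IH Q cQ Qx.
  by exists P1; split=> //; exact: pchainS QP.
inversion cQ as [|k' P' T Q' cT PQ TQ]; subst.
have PT := pchain_prime cT.
have [P' [PP' xP' P'P]] : exists P', [/\ prime_ideal P', adj T x `<=` P' & P' `<` P].
  apply: contrapT => nP'.
  have mP : minimal_over (adj T x) P.
    split=> //.
      by apply: adj_sub => // z Tz; apply: (proj1 QP); exact: (proj1 TQ).
    move=> S PS xS SP; apply: contrapT => nPS; apply: nP'.
    by exists S.
  by apply: (proj2 TQ); exact: principal_ideal_theorem (proj1 TQ) QP mP.
have [||P1 [cP1 P01 P1x]] := IH P'.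
- apply: pchainS cT PP' _; split.
    by move=> z Tz; apply: xP'; exact: sub_adj.
  move=> P'T; apply: nQx; apply: (proj1 TQ); apply: P'T; apply: xP'.
  exact: adj_in.
- by apply: xP'; exact: adj_in.
by exists P1; split=> //; exact: pchainS P'P.
Qed.

(** Pushing the first generator into the chain costs one link, and the new bottom prime absorbs that
    generator. *)
Lemma height_theorem k P0 P s : pchain k P0 P -> minimal_over (adjs P0 s) P ->
  (k <= size s)%N.
Proof.
elim: s k P0 => [|x s IH] [|k] P0 cP [PP sP minP] //.
  inversion cP as [|k' P' Q Q' cQ _ [QP nPQ]]; subst.
  exfalso; apply: nPQ => z Pz; apply: (pchain_sub cQ).
  by apply: minP Pz => //; exact: pchain_primel cQ.
have [|P1 [cP1 P01 P1x]] := pchain_push cP (x := x).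
  by apply: sP; exact: adj_in.
rewrite ltnS; apply: (IH _ _ cP1); split=> //.
  apply: adjs_sub; first exact: pchain_sub cP1.
  by move=> y ys; apply: sP; apply: sub_adj; exact: adjs_in.
move=> Q PQ P1Q; apply: minP => //=; apply: adj_sub.
  by move=> z h; apply: P1Q; move: z h; exact: adjs_le.
by apply: P1Q; exact: sub_adjs.
Qed.

(* The image of [P] in [R / I] is not minimal over any ideal with fewer than [d]
   generators, i.e. that image has height at least [d]. *)
Definition height_ge I P d := forall s, (size s < d)%N -> ~ minimal_over (adjs I s) P.

Lemma height_ge_adj I P d x : height_ge I P d.+1 -> height_ge (adj I x) P d.
Proof. by move=> h s sd; rewrite adjs_adj; apply: (h (x :: s)). Qed.

Lemma height_ge_prime I P d : prime_ideal P -> I `<=` P -> height_ge I P d.+1 ->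
  exists Q, [/\ prime_ideal Q, I `<=` Q & Q `<` P].
Proof.
move=> PP IP /(_ [::] isT) nm; apply: contrapT => nQ; apply: nm; split=> // Q PQ IQ QP.
by apply: contrapT => nPQ; apply: nQ; exists Q.
Qed.

Lemma pchain_height_ge k P0 P I : I `<=` P0 -> pchain k P0 P -> height_ge I P k.
Proof.
move=> IP0 cP s; rewrite ltnNge => /negP sk [PP sP minP]; apply: sk.
have [sP0|nsP0] := pselect (adjs P0 s `<=` P).
  apply: height_theorem cP _; split=> // Q PQ P0Q; apply: minP => // z h.
  by apply: P0Q; move: z h; exact: adjs_le.
exfalso; apply: nsP0; apply: adjs_sub; first exact: pchain_sub cP.
by move=> x xs; apply: sP; exact: adjs_in.
Qed.

(** An element [x] of [P] outside the listed primes over [I] that do not contain [P] lowers the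
    bound by one. The chain over $I + (x)$ is then extended downwards by a listed prime, which
    misses [x]. *)
Lemma height_ge_pchain d I P : prime_ideal P -> I `<=` P -> height_ge I P d ->
  exists2 P0 : ideal R, I `<=` P0 & pchain d P0 P.
Proof.
move=> PP; elim: d I => [|d IH] I IP hI; first by exists P => //; exact: pchain0.
have [Ps [PsP Psmin]] := minimal_primes I.
have [x Px nPx] : exists2 x, P x & forall Q, Q \in Ps -> ~ P `<=` Q -> ~ Q x.
  have [|x Px nx] := @coset_prime_avoidance P 0
      [seq Q : ideal R <- Ps | `[< ~ P `<=` Q >]].
    move=> Q; rewrite mem_filter => /andP[/asboolP nPQ /PsP[PQ _]].
    by split=> // -[].
  exists x => // Q QPs nPQ; rewrite -[x]add0r; apply: nx.
  by rewrite mem_filter QPs andbT; exact/asboolP.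
have [||P1 xP1 cP1] := IH (adj I x); [exact: adj_sub|exact: height_ge_adj|].
have IP1 : I `<=` P1 by move=> z Iz; apply: xP1; exact: sub_adj.
have [Q QPs QP1] := Psmin P1 (pchain_primel cP1) IP1.
(* If $P \subseteq Q$, the chain found is trivial and $d = 0$, so any prime over [I] strictly below
   [P] suffices. *)
have [PQ|nPQ] := pselect (P `<=` Q).
  have EP : P1 = P.
    by apply: ideal_ext; [exact: pchain_sub cP1|move=> z /PQ/QP1].
  have d0 : d = 0%N.
    move: cP1; rewrite EP => cP1; apply/eqP; rewrite -leqn0.
    apply: (@height_theorem _ P P [::] cP1); split=> //.
  have [T [PT IT TP]] := height_ge_prime PP IP hI.
  by exists T => //; rewrite d0; exact: pchainS (pchain0 PT) _ _.
have [PQ IQ] := PsP Q QPs; exists Q => //.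
apply: pchain_cons cP1 => //; split=> // P1Q.
by apply: (nPx Q QPs nPQ); apply: P1Q; apply: xP1; exact: adj_in.
Qed.

(* A regular local ring is a domain, relative to an ideal [I]. *)
Lemma height_ge_generators_prime M I s : local_at M -> M = adjs I s ->
  height_ge I M (size s) -> prime_ideal I.
Proof.
move=> lM; elim: s I => [|x s IH] I MI hI.
  by have := local_at_prime lM; rewrite MI.
have PM := local_at_prime lM.
have IM : I `<=` M by rewrite MI; exact: sub_adjs.
have [Ps [PsP Psmin]] := minimal_primes I.
(* The first generator is changed by a combination of the others. A prime over [I] containing all
   the generators contains [M], so avoidance applies to the listed primes that do not. *)
have [y sy nPy] : exists2 y, adjs (zero_ideal R) s y &
    forall P, P \in Ps -> ~ M `<=` P -> ~ P (x + y).
  have [|y sy ny] := @coset_prime_avoidance (adjs (zero_ideal R) s) x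
      [seq P : ideal R <- Ps | `[< ~ M `<=` P >]].
    move=> P; rewrite mem_filter => /andP[/asboolP nMP /PsP[PP IP]].
    split=> // -[Px sP]; apply: nMP; rewrite MI; apply: adjs_sub => //.
    move=> z; rewrite inE => /predU1P[->//|zs].
    by apply: sP; exact: adjs_in.
  exists y => // P PPs nMP; apply: ny.
  by rewrite mem_filter PPs andbT; exact/asboolP.
pose I' := adj I (x + y).
have MI' : M = adjs I' s.
  rewrite adjs_adj MI /=; apply: ideal_ext; apply: adj_sub; try exact: sub_adj.
    apply: (@ideal_Dl _ (adj _ _) y); last by rewrite addrC; exact: adj_in.
    by apply: sub_adj; move: y sy {nPy I'}; apply: adjs_le; exact: zero_sub.
  apply: ideal_D; first exact: adj_in.
  by apply: sub_adj; move: y sy {nPy I'}; apply: adjs_le; exact: zero_sub.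
have PI' : prime_ideal I' by apply: IH => //; exact: height_ge_adj.
have [Q [PQ IQ QI' nQx]] :
    exists Q, [/\ prime_ideal Q, I `<=` Q, Q `<=` I' & ~ Q (x + y)].
  have [P PPs PI1] := Psmin I' PI' (@sub_adj _ I (x + y)).
  have [PP IP] := PsP P PPs.
  have [MP|nMP] := pselect (M `<=` P); last by exists P; split=> //; exact: nPy.
  have [T [PT IT [TM nMT]]] := height_ge_prime PM IM hI.
  exists T; split=> // [z /TM/MP/PI1//|Tx]; apply: nMT.
  by move=> z /MP/PI1; exact: adj_sub.
suff QI : Q `<=` I by rewrite (ideal_ext IQ QI).
(* An element of [Q] is $a + r(x+y)$ with $a \in I$; since $x + y \notin Q$, also $r \in Q$. Hence
   $Q \subseteq I + MQ$. *)
apply: (nakayama_local lM); first exact: noetherian_fg.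
move=> z Qz; have [a [r [Ia e]]] := QI' z Qz.
exists a, (r * (x + y)); split=> //.
rewrite mulrC; apply: mul_in; first by rewrite MI'; apply: sub_adjs; exact: adj_in.
suff: Q (r * (x + y)) by move=> /(proj2 PQ)[].
by apply: (@ideal_Dl _ Q a); [exact: IQ|rewrite -e].
Qed.

End Noetherian.

(** * Noetherian criteria and zero divisors *)

Section Cohen.
Variable R : comPzRingType.
Implicit Types (I J L P M : ideal R) (x y z : R) (s t : seq R).

(** Subtracting multiples of [u] moves the given generators into [P]. *)
Lemma fg_adj_lift P u : fg (adj P u) ->
  exists t, (forall x, x \in t -> P x) /\ adj P u `<=` adj (adjs (zero_ideal R) t) u.
Proof.
move=> [s Es].
have: forall z, z \in s -> adj P u z by move=> z zs; rewrite Es; exact: adjs_in.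
suff h : (forall z, z \in s -> adj P u z) -> exists t, (forall x, x \in t -> P x) /\
    forall z, z \in s -> adj (adjs (zero_ideal R) t) u z.
  move=> /h[t [tP st]]; exists t; split=> //; rewrite Es.
  by apply: adjs_sub => //; exact: zero_sub.
elim: s {Es} => [|z s IH] sP; first by exists [::].
have [|t [tP st]] := IH; first by move=> w ws; apply: sP; rewrite inE ws orbT.
have [p [r [Pp zE]]] := sP z (mem_head _ _).
exists (p :: t); split=> [x|w]; rewrite inE; first by move=> /predU1P[->|/tP].
move=> /predU1P[->|/st]; last by apply: adj_le; exact: sub_adj.
by rewrite zE; exists p, r; split=> //; exact: adj_in.
Qed.

(** Zorn's lemma: generators of the union of a chain would lie in one member, which would then be
    the whole union and finitely generated. *)
Lemma non_fg_maximal I : ~ fg I -> exists P, [/\ I `<=` P, ~ fg P &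
  forall J, P `<=` J -> ~ fg J -> J `<=` P].
Proof.
move=> nI; pose T := {J : ideal R | I `<=` J /\ ~ fg J}.
have I0 : I `<=` I /\ ~ fg I by split.
pose le (u v : T) := `[< sval u `<=` sval v >].
have [||A totA|[P [IP nP]] Pmax] := @ZL_preorder T (exist _ I I0) le.
- by move=> u; apply/asboolP.
- by move=> v u w /asboolP uv /asboolP vw; apply/asboolP => z /uv/vw.
- have [[t0 At0]|nA] := pselect (exists t : T, A t); last first.
    by exists (exist _ I I0) => s As; exfalso; apply: nA; exists s.
  have UD x y : (exists2 u, A u & sval u x) -> (exists2 u, A u & sval u y) ->
      exists2 u, A u & sval u x /\ sval u y.
    move=> [u Au ux] [v Av vy].
    have /orP[/asboolP uv|/asboolP vu] : le u v || le v u by apply/orP; exact: totA.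
      by exists v => //; split=> //; exact: uv.
    by exists u => //; split=> //; exact: vu.
  have U0 : exists2 u, A u & sval u 0 by exists t0 => //; exact: ideal_0.
  have UA x y : (exists2 u, A u & sval u x) -> (exists2 u, A u & sval u y) ->
      exists2 u, A u & sval u (x + y).
    by move=> hx /(UD _ _ hx)[u Au [ux uy]]; exists u => //; exact: ideal_D.
  have UM a x : (exists2 u, A u & sval u x) -> exists2 u, A u & sval u (a * x).
    by move=> [u Au ux]; exists u => //; exact: ideal_M.
  pose U := @Ideal R [set z | exists2 u, A u & sval u z] U0 UA UM.
  have IU : I `<=` U by move=> z Iz; exists t0 => //; exact: (proj1 (svalP t0)).
  have nU : ~ fg U.
    move=> [s Es].
    have [u Au us] : exists2 u, A u & forall x, x \in s -> sval u x.
      have: forall x, x \in s -> U x by move=> x xs; rewrite Es; exact: adjs_in.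
      elim: (s) => [|y t IH] tU; first by exists t0.
      have [|u Au ut] := IH; first by move=> x xt; apply: tU; rewrite inE xt orbT.
      have [v Av vy] := tU y (mem_head _ _).
      have /orP[/asboolP uv|/asboolP vu] : le u v || le v u by apply/orP; exact: totA.
        exists v => // x; rewrite inE => /predU1P[->//|/ut]; exact: uv.
      exists u => // x; rewrite inE => /predU1P[->|/ut//]; exact: vu.
    apply: (proj2 (svalP u)); exists s; rewrite -Es; apply: ideal_ext.
      by move=> z uz; exists u.
    by rewrite Es; apply: adjs_sub => //; exact: zero_sub.
  exists (exist _ U (conj IU nU)) => u Au; apply/asboolP => z uz.
  by exists u.
exists P; split=> // J PJ nJ.
have IJ : I `<=` J /\ ~ fg J by split=> // z /IP/PJ.
by have /asboolP := Pmax (exist _ J IJ) (asboolT PJ).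
Qed.

(** Cohen's theorem. If $uv \in P$ with $u, v \notin P$, maximality makes $P + (u)$ and $(P:u)$
    finitely generated, and then so is $P = (t) + u (P:u)$, with [t] taken from [fg_adj_lift]. *)
Lemma cohen I : ~ fg I -> exists P, [/\ prime_ideal P, I `<=` P & ~ fg P].
Proof.
move=> /non_fg_maximal[P [IP nP Pmax]]; exists P; split=> //; split.
  move=> P1; apply: nP; exists [:: 1]; apply: ideal_ext => x _.
    by apply: (@ideal_full _ (adj _ 1)); exact: adj_in.
  exact: ideal_full.
move=> u v Puv; apply: contrapT => /not_orP[nu nv]; apply: nP.
have [t [tP Pt]] : exists t, (forall x, x \in t -> P x) /\
    adj P u `<=` adj (adjs (zero_ideal R) t) u.
  apply: fg_adj_lift; apply: contrapT => nf; apply: nu.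
  by apply: Pmax nf _ _; [exact: sub_adj|exact: adj_in].
have [s Es] : fg (ideal_colon P u).
  apply: contrapT => nf; apply: nv; apply: Pmax nf _ _.
    by move=> z Pz; exact: (@ideal_Mr _ P).
  by rewrite /ideal_colon /= mulrC.
exists ([seq r * u | r <- s] ++ t); rewrite adjs_cat; apply: ideal_ext; last first.
  apply: adjs_sub; first by apply: adjs_sub => //; exact: zero_sub.
  move=> _ /mapP[r rs ->]; have : ideal_colon P u r by rewrite Es; exact: adjs_in.
  by [].
move=> z Pz; have [p [r [tp zE]]] := Pt z (sub_adj u Pz).
rewrite zE; apply: ideal_D; first exact: sub_adjs.
have Pp : P p by move: p tp {zE}; apply: adjs_sub => //; exact: zero_sub.
set J := adjs _ [seq _ | _ <- _]; suff: ideal_colon P u `<=` ideal_colon J u.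
  by apply; apply: (@ideal_Dl _ P p); rewrite -?zE.
rewrite Es; apply: adjs_sub => [|w ws]; first exact: zero_sub.
by apply: adjs_in; apply/mapP; exists w.
Qed.

(** Induction on the generators of [M] still missing from a finitely generated [J], for all ideals
    above [J]. A prime containing the next generator [x] falls under the induction hypothesis; for
    the others, closedness is used. *)
Lemma closed_noetherian M : local_at M -> fg M ->
  (forall J, fg J -> forall z, (forall n, ideal_add J (ideal_pow M n) z) -> J z) ->
  noetherian R.
Proof.
move=> lM [s Es] closed; apply: fg_noetherian => I.
have : M = adjs (zero_ideal R) s by [].
have : fg (zero_ideal R) by exists [::].
have : zero_ideal R `<=` I by exact: zero_sub.
elim: s (zero_ideal R) I {Es} => [|x s IH] J I JI fJ MJ.
  have [I1|nI1] := pselect (I 1).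
    exists [:: 1]; apply: ideal_ext => z _; last exact: ideal_full.
    by apply: (@ideal_full _ (adj _ 1)); exact: adj_in.
  suff -> : I = J by [].
  by apply: ideal_ext => //; rewrite -[J]MJ; exact: local_at_sub.
apply: contrapT => /cohen[P [PP IP nP]].
have fxJ : fg (adj J x) by exact: fg_adj.
have ME : M = adjs (adj J x) s by rewrite adjs_adj.
have [Px|nPx] := pselect (P x).
  by apply: nP; apply: IH fxJ ME; apply: adj_sub => // z /JI/IP.
have [|t [tP Pt]] := @fg_adj_lift P x.
  by apply: IH fxJ ME; apply: adj_le => z /JI/IP.
set L := adjs _ t in Pt.
have LP : L `<=` P by apply: adjs_sub => //; exact: zero_sub.
apply: nP; exists t; apply: ideal_ext => // z Pz.
apply: closed => [|n]; first by exists t.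
(* Each reduction modulo [L] leaves a multiple of [x] in [P], whose cofactor is again in [P] because
   $x \notin P$. Thus $P \subseteq L + x^n P$ for every [n]. *)
have [c Pc Lc] : exists2 c, P c & L (z - c * x ^+ n).
  elim: n => [|n [c Pc Lc]].
    by exists z => //; rewrite expr0 mulr1 subrr; exact: ideal_0.
  have [l [r [Ll cE]]] := Pt c (sub_adj x Pc).
  exists r.
    have Prx : P (r * x) by apply: (@ideal_Dl _ P l); [exact: LP|rewrite -cE].
    by case: PP => _ /(_ _ _ Prx)[].
  have -> : z - r * x ^+ n.+1 = (z - c * x ^+ n) + x ^+ n * l.
    by rewrite cE exprS; ring.
  by apply: ideal_D => //; exact: ideal_M.
exists (z - c * x ^+ n), (c * x ^+ n); split=> //; last by rewrite subrK.
by apply: ideal_M; apply: pow_exp; rewrite ME; apply: sub_adjs; exact: adj_in.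
Qed.

End Cohen.

(** * Zero divisors modulo an ideal *)

Section NonZeroDivisor.
Variable R : comPzRingType.
Hypothesis nR : noetherian R.
Implicit Types (I P M : ideal R) (x y z : R) (s : seq R).

(** The maximal proper colons $(I:b)$ are prime and cover the zero divisors. Finitely many suffice
    because the ideal generated by all such [b] is finitely generated. *)
Lemma zero_divisors_primes I : exists Ps : seq (ideal R),
  (forall P, P \in Ps -> prime_ideal P /\ exists2 a, ~ I a & P = ideal_colon I a) /\
  (forall y a, I (y * a) -> ~ I a -> exists2 P, P \in Ps & P y).
Proof.
pose B b := ~ I b /\ forall a, ~ I a -> ideal_colon I b `<=` ideal_colon I a ->
  ideal_colon I a `<=` ideal_colon I b.
have [|_ [[s -> sB] smax]] := @noetherian_maximal _ nR
    (fun J => exists2 s, J = adjs (zero_ideal R) s & forall b, b \in s -> B b).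
  by exists (zero_ideal R), [::].
have Bprime b : B b -> prime_ideal (ideal_colon I b).
  move=> [nb bmax]; split; first by rewrite /ideal_has /= mul1r.
  move=> u v buv; have [ub|nub] := pselect (ideal_colon I b u); [by left|right].
  apply: (bmax (u * b)) => // [w wb|].
    by rewrite /ideal_colon /= mulrCA; exact: (@ideal_M _ I).
  by rewrite /ideal_colon /= mulrA [v * u]mulrC.
exists [seq ideal_colon I b | b <- s]; split.
  by move=> _ /mapP[b /sB Bb ->]; split; [exact: Bprime|exists b => //; case: Bb].
move=> y a Iya na.
have [|_ [[b -> [nb ab]] bmax]] := @noetherian_maximal _ nR (fun J =>
    exists2 b, J = ideal_colon I b & ~ I b /\ ideal_colon I a `<=` ideal_colon I b).
  by exists (ideal_colon I a), a => //; split.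
have Bb : B b.
  split=> // c nc bc; apply: bmax => //; exists c => //; split=> // z /ab; exact: bc.
have sb : adjs (zero_ideal R) s b.
  apply: (smax (adjs (zero_ideal R) (b :: s))); last exact: adj_in.
    by exists (b :: s) => // c; rewrite inE => /predU1P[->|/sB].
  exact: sub_adj.
(* As [b] is a combination of [s], the intersection of the $(I:c)$ lies in the prime $(I:b)$, hence
   one of them does. *)
have [c cs cb] : exists2 c, c \in s & ideal_colon I c `<=` ideal_colon I b.
  apply: contrapT => nc.
  have [w bw ws] : exists2 w, ~ ideal_colon I b w & forall c, c \in s -> I (w * c).
    have: forall c, c \in s -> ~ ideal_colon I c `<=` ideal_colon I b.
      by move=> c cs cb; apply: nc; exists c.
    elim: (s) => [|c t IH] tb; first by exists 1 => //; case: (Bprime b Bb).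
    have [|w bw wt] := IH; first by move=> d dt; apply: tb; rewrite inE dt orbT.
    have /existsNP[v /not_implyP[cv nbv]] := tb c (mem_head _ _).
    exists (v * w); first by apply: prime_mul => //; exact: Bprime.
    move=> d; rewrite inE => /predU1P[->|/wt dw].
      by rewrite mulrAC; exact: ideal_Mr.
    by rewrite -mulrA; exact: ideal_M.
  apply: bw; rewrite /ideal_has /= mulrC.
  apply: (@adjs_sub _ _ s (ideal_colon I w)) sb => [|c /ws]; first exact: zero_sub.
  by rewrite mulrC.
exists (ideal_colon I c); first exact: map_f.
by have [_ cmax] := sB c cs; apply: (cmax b nb cb); apply: ab.
Qed.

Lemma local_nonzerodivisor M I : local_at M ->
  (forall a, (forall z, M z -> I (z * a)) -> I a) ->
  exists2 y, M y & forall a, I (y * a) -> I a.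
Proof.
move=> lM MI; have [Ps [PsP Psz]] := zero_divisors_primes I.
have [|y My ny] := @coset_prime_avoidance _ M 0 Ps.
  move=> P /PsP[PP [a na EP]]; split=> // -[_ MP]; apply: na; apply: MI => z /MP.
  by rewrite EP.
exists y => // a Iya; apply: contrapT => na.
by have [P PPs Py] := Psz y a Iya na; apply: (ny P PPs); rewrite add0r.
Qed.

End NonZeroDivisor.

(** * The Koszul complex *)

Section KoszulComplex.
Variables (R : comPzRingType) (n : nat) (x : 'I_n -> R).
Implicit Types (f g h y z : {ffun {set 'I_n} -> R}) (S T : {set 'I_n}) (I : ideal R).

Local Notation below S j := #|[pred k in S | (k < j)%N]|.

Lemma below_setU1 S j l : j \notin S ->
  below (j |: S)%SET l = ((j < l) + below S l)%N.
Proof.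
move=> jS; rewrite -!sum1_card !big_mkcondr /= big_setU1 //=.
Qed.

Lemma below_set0 (j : 'I_n) : below (finset.set0 : {set 'I_n}) j = 0%N.
Proof. by apply: eq_card0 => k; rewrite !inE. Qed.

Lemma koszul_dE f S : koszul_d x f S =
  \sum_(j | j \notin S) (-1) ^+ below S j * x j * f (j |: S)%SET.
Proof. by rewrite ffunE. Qed.

Lemma koszul_d_linear a f g :
  koszul_d x [ffun S => f S + a * g S] =
  [ffun S => koszul_d x f S + a * koszul_d x g S].
Proof.
apply/ffunP => S; rewrite !ffunE mulr_sumr -big_split.
by apply: eq_bigr => j _; rewrite !ffunE /=; ring.
Qed.

Lemma koszul_d_chain i f : koszul_chain i.+1 f -> koszul_chain i (koszul_d x f).
Proof.
move=> cf S Si; rewrite koszul_dE big1 // => j jS.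
by rewrite cf ?mulr0 // cardsU1 jS.
Qed.

Lemma koszul_dd f : koszul_d x (koszul_d x f) = 0.
Proof.
apply/ffunP => S; rewrite koszul_dE ffunE.
pose F (j l : 'I_n) := (-1) ^+ below S j * x j *
  ((-1) ^+ below (j |: S)%SET l * x l * f (l |: (j |: S))%SET).
pose c (j l : 'I_n) := [&& j \notin S, l \notin S & (j < l)%N].
(* The two orders of inserting a pair $j < l$ cancel: having [j] present first shifts the sign at
   [l] by one, while having [l] present does not affect the sign at [j]. *)
transitivity (\sum_j \sum_(l | c j l) F j l + \sum_j \sum_(l | c l j) F j l).
  rewrite -big_split big_mkcond; apply: eq_bigr => j _ /=.
  have [jS|jS] := boolP (j \in S).
    by rewrite !big_pred0 ?addr0 // => l; rewrite /c jS ?andbF.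
  rewrite koszul_dE mulr_sumr (bigID (fun l : 'I_n => (j < l)%N)) /=.
  congr (_ + _); apply: eq_bigl => l; rewrite /c jS !inE negb_or.
    by rewrite -(inj_eq val_inj) /=; case: ltngtP => _; rewrite ?andbT ?andbF.
  by rewrite -(inj_eq val_inj) /=; case: ltngtP => _; rewrite ?andbT ?andbF.
rewrite [X in _ + X](exchange_big_dep xpredT) //= -big_split big1 // => j _.
rewrite -big_split big1 // => l /and3P[jS lS jl] /=.
rewrite /F !below_setU1 // jl (ltnNge l j) (ltnW jl) /= add0n add1n exprS.
by rewrite finset.setUCA; ring.
Qed.

(** Vanishing of $H_i(x; R/I)$, written with lifts of chains to [R]. *)
Definition kexact I i := forall z, koszul_chain i z ->
  (forall S, I (koszul_d x z S)) ->
  exists y, koszul_chain i.+1 y /\ forall S, I (z S - koszul_d x y S).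

Lemma kexact_homology i :
  kexact (zero_ideal R) i <-> ~ koszul_homology_neq0 x i.
Proof.
split=> [ex [z [cz dz nz]]|nh z cz dz].
  apply: nz; have [|y [cy yz]] := ex z cz; first by move=> S; rewrite dz ffunE.
  exists y; split=> //; apply/ffunP => S.
  by apply/esym/eqP; rewrite -subr_eq0; apply/eqP; exact: yz.
apply: contrapT => ny; apply: nh; exists z; split=> //.
  by apply/ffunP => S; rewrite [RHS]ffunE; have := dz S.
by move=> [y [cy yz]]; apply: ny; exists y; split=> // S; rewrite yz subrr.
Qed.

Lemma kexact_large I i : (n < i)%N -> kexact I i.
Proof.
move=> ni z cz _; exists 0; split=> [S _|S]; first by rewrite ffunE.
have -> : z S = 0.
  by apply: cz; rewrite neq_ltn (leq_ltn_trans _ ni) // -[leqRHS]card_ord max_card.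
suff -> : koszul_d x 0 = 0 by rewrite ffunE subrr; exact: ideal_0.
by apply/ffunP => T; rewrite koszul_dE ffunE big1 // => j _; rewrite ffunE mulr0.
Qed.

(** A piece of the long exact sequence for multiplication by [b] on $R/I$: the homology of
    $R/(I+(b))$ in degree $i+1$ sits between $H_{i+1}(x; R/I)$ and $H_i(x; R/I)$. *)
Lemma kexact_adj I b i : (forall a, I (b * a) -> I a) ->
  kexact I i -> kexact I i.+1 -> kexact (adj I b) i.+1.
Proof.
move=> yI exi exS z cz dz.
(* The decomposition is set to zero off degree [i], so that its coefficients [w] form a chain. *)
have /choice[p pP] S : exists p, [/\ I p.1, koszul_d x z S = p.1 + p.2 * b &
    #|S| != i -> p = (0, 0)].
  have [Si|Si] := boolP (#|S| != i); last by have [a [r [Ia e]]] := dz S; exists (a, r).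
  exists (0, 0); split=> //=; first exact: ideal_0.
  by rewrite mul0r addr0 (koszul_d_chain cz).
pose u : {ffun {set 'I_n} -> R} := [ffun S => (p S).1].
pose w : {ffun {set 'I_n} -> R} := [ffun S => (p S).2].
have dzE : koszul_d x z = [ffun S => u S + b * w S].
  by apply/ffunP => S; rewrite !ffunE; have [_ + _] := pP S; rewrite ffunE mulrC.
have cw : koszul_chain i w.
  by move=> S Si; rewrite ffunE; have [_ _ ->] := pP S.
have dw S : I (koszul_d x w S).
  apply: yI; apply: (@ideal_Dl _ I (koszul_d x u S)).
    rewrite koszul_dE; apply: ideal_sum => j _; apply: ideal_M.
    by rewrite ffunE; have [] := pP (j |: S)%SET.
  have := koszul_dd z; rewrite dzE koszul_d_linear => /ffunP/(_ S).
  by rewrite !ffunE => ->; exact: ideal_0.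
have [v [cv wv]] := exi w cw dw.
pose z' := [ffun S => z S + (- b) * v S].
have cz' : koszul_chain i.+1 z'.
  by move=> S Si; rewrite ffunE cz // cv // mulr0 addr0.
have [|t [ct zt]] := exS z' cz'.
  move=> S; rewrite koszul_d_linear ffunE dzE ffunE.
  have -> : u S + b * w S + - b * koszul_d x v S = u S + b * (w S - koszul_d x v S).
    by ring.
  by apply: ideal_D; [rewrite ffunE; have [] := pP S|apply: ideal_M; exact: wv].
exists t; split=> // S; exists (z' S - koszul_d x t S), (v S); split=> //.
by rewrite [z' S]ffunE; ring.
Qed.

(** In top degree there are no nonzero boundaries, and the cycles are the elements of $R/I$ killed
    by all [x j]. *)
Lemma kexact_top I : kexact I n -> forall a, (forall j, I (x j * a)) -> I a.
Proof.
move=> ex a Ia; pose z : {ffun {set 'I_n} -> R} :=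
  [ffun S : {set 'I_n} => if S == [set: 'I_n]%SET then a else 0].
have [S|S|y [cy zy]] := ex z.
- move=> Sn; rewrite ffunE; case: eqP => // ST.
  by rewrite ST cardsT card_ord eqxx in Sn.
- rewrite koszul_dE; apply: ideal_sum => j _; rewrite ffunE -mulrA.
  apply: ideal_M; case: eqP => _; first exact: Ia.
  by rewrite mulr0; exact: ideal_0.
have := zy [set: 'I_n]%SET; rewrite ffunE eqxx koszul_dE big_pred0 ?subr0 // => j.
by rewrite inE.
Qed.

Definition supp k f := forall S, ~~ [forall j in S, (j < k)%N] -> f S = 0.

(* This is [f /\ e_m] when [f] is supported on the indices below [m]. *)
Definition wedge (m : 'I_n) f : {ffun {set 'I_n} -> R} :=
  [ffun S : {set 'I_n} => if m \in S then f (S :\ m)%SET else 0].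

Lemma supp_mem (m : 'I_n) f (S : {set 'I_n}) : supp m f -> m \in S -> f S = 0.
Proof.
by move=> + mS; apply; apply/forall_inPn; exists m => //; rewrite ltnn.
Qed.

Lemma supp_setU1 (m : 'I_n) f (S : {set 'I_n}) : supp m f -> f (m |: S)%SET = 0.
Proof. by move=> /supp_mem; apply; rewrite finset.setU11. Qed.

(** Since [f] involves only indices below [m], the factor $e_m$ comes last, and removing it passes
    [i] factors. *)
Lemma koszul_d_wedge i (m : 'I_n) f : koszul_chain i f -> supp m f ->
  koszul_d x (wedge m f) =
  [ffun S => wedge m (koszul_d x f) S + (-1) ^+ i * x m * f S].
Proof.
move=> cf sf; apply/ffunP => S; rewrite koszul_dE [RHS]ffunE [wedge _ _ S]ffunE.
have [mS|mS] := boolP (m \in S).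
  rewrite (supp_mem sf mS) mulr0 addr0 koszul_dE.
  rewrite [RHS](bigD1 m) /= ?finset.setD11 // (supp_setU1 _ sf) mulr0 add0r.
  apply: eq_big => [j|j jS]; first by rewrite !inE;
    case: (eqVneq j m) => [->|_]; rewrite ?mS ?andbT ?andbF.
  rewrite ffunE !inE mS orbT.
  have jm : j != m by apply: contraNneq jS => ->.
  have -> : ((j |: S) :\ m = j |: (S :\ m))%SET.
    by apply/setP => l; rewrite !inE; case: (l =P j) => [->|//]; rewrite jm.
  have [jltm|mltj] := ltnP j m.
    congr (_ ^+ _ * _ * _); apply: eq_card => l; rewrite !inE.
    by case: eqP => [->|//]; rewrite ltnNge (ltnW jltm) !andbF.
  rewrite sf ?mulr0 //; apply/forall_inPn; exists j; rewrite ?finset.setU11 //.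
  by rewrite -leqNgt.
rewrite add0r (bigD1 m) //= ffunE finset.setU11 finset.setU1K //.
rewrite [X in _ + X]big1 ?addr0 => [|j /andP[jS jm]]; last first.
  by rewrite ffunE !inE (negbTE mS) orbF eq_sym (negbTE jm) mulr0.
have [Sm|Sm] := boolP [forall j in S, (j < m)%N]; last by rewrite sf // !mulr0.
have [Si|Si] := eqVneq #|S| i; last by rewrite cf // !mulr0.
congr (_ ^+ _ * _ * _); rewrite -Si; apply: eq_card => l; rewrite !inE.
by have [/(forall_inP Sm)//|] := boolP (l \in S).
Qed.

(** Padding with zeros keeps the index type ['I_n] for every [k]. *)
Definition initial_ideal k :=
  ideal_gen (range (fun l : 'I_n => if (l < k)%N then x l else 0)).

(** The Koszul complex as an iterated mapping cone: write $f = f_1 + f_2 \wedge e_m$, with $f_1$ and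
    $f_2$ supported below [m]. Then $df = 0$ says $df_2 = 0$ and $df_1 = -(-1)^i x_m f_2$. *)
Lemma koszul_acyclic_supp k : (k <= n)%N ->
  (forall (m : 'I_n) a, initial_ideal m (x m * a) -> initial_ideal m a) ->
  forall i f, koszul_chain i.+1 f -> supp k f -> koszul_d x f = 0 ->
  exists y, [/\ koszul_chain i.+2 y, supp k y & koszul_d x y = f].
Proof.
move=> + reg; elim: k => [_ i f cf sf _|k IH kn i f cf sf df].
  have -> : f = 0.
    apply/ffunP => S; rewrite ffunE; have [S0|/set0Pn[j jS]] := eqVneq S finset.set0.
      by rewrite cf // S0 cards0.
    by apply: sf; apply/forall_inPn; exists j.
  exists 0; split=> [S _|S _|]; rewrite ?ffunE //.
  by apply/ffunP => S; rewrite koszul_dE big1 ?ffunE // => j _; rewrite ffunE mulr0.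
pose m := Ordinal kn.
have suppS g S : supp k.+1 g -> m \notin S -> ~~ [forall j in S, (j < k)%N] -> g S = 0.
  move=> sg mS /forall_inPn[j jS jk]; apply: sg; apply/forall_inPn; exists j => //.
  rewrite ltnS -ltnNge ltn_neqAle; apply/andP; split; last by rewrite leqNgt.
  by apply: contraNneq mS => mj; rewrite (_ : m = j) //; exact: val_inj.
pose f1 : {ffun {set 'I_n} -> R} := [ffun S : {set 'I_n} => if m \in S then 0 else f S].
pose f2 : {ffun {set 'I_n} -> R} :=
  [ffun S : {set 'I_n} => if m \in S then 0 else f (m |: S)%SET].
have fE : f = [ffun S => f1 S + 1 * wedge m f2 S].
  apply/ffunP => S; rewrite !ffunE; have [mS|mS] := boolP (m \in S).
    by rewrite finset.setD11 finset.setD1K // add0r mul1r.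
  by rewrite mulr0 addr0.
have s1 : supp m f1.
  by move=> S Sk; rewrite ffunE; case: ifPn => // mS; exact: suppS.
have s2 : supp m f2.
  move=> S Sk; rewrite ffunE; case: ifPn => // mS; apply: sf.
  move: Sk => /forall_inPn[j jS jk]; apply/forall_inPn; exists j.
    by rewrite inE jS orbT.
  rewrite ltnS -ltnNge ltn_neqAle; apply/andP; split; last by rewrite leqNgt.
  by apply: contraNneq mS => mj; rewrite (_ : m = j) //; exact: val_inj.
have c1 : koszul_chain i.+1 f1.
  by move=> S Si; rewrite ffunE cf //; case: ifP.
have c2 : koszul_chain i f2.
  by move=> S Si; rewrite ffunE; case: ifPn => // mS; rewrite cf // cardsU1 mS.
have dfE : koszul_d x f = [ffun S => koszul_d x f1 S +
    (wedge m (koszul_d x f2) S + (-1) ^+ i * x m * f2 S)].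
  rewrite {1}fE koszul_d_linear (koszul_d_wedge c2 s2).
  by apply/ffunP => S; rewrite !ffunE mul1r.
have dfS S : koszul_d x f1 S + ((if m \in S then koszul_d x f2 (S :\ m)%SET else 0) +
    (-1) ^+ i * x m * f2 S) = 0.
  transitivity (koszul_d x f S); last by rewrite df ffunE.
  by rewrite dfE [RHS]ffunE; congr (_ + (_ + _)); rewrite [RHS]ffunE.
have supp_d g S : supp m g -> m \in S -> koszul_d x g S = 0.
  move=> sg mS; rewrite koszul_dE big1 // => j _.
  by rewrite (supp_mem sg) ?mulr0 // inE mS orbT.
have d2 : koszul_d x f2 = 0.
  apply/ffunP => S; rewrite [RHS]ffunE; have [mS|mS] := boolP (m \in S).
    exact: supp_d.
  have := dfS (m |: S)%SET; rewrite (supp_d f1) ?finset.setU11 // finset.setU1K //.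
  by rewrite (supp_setU1 _ s2) mulr0 addr0 add0r.
have d1 S : koszul_d x f1 S + (-1) ^+ i * x m * f2 S = 0.
  have [mS|mS] := boolP (m \in S); first by rewrite supp_d // (supp_mem s2) // mulr0 addr0.
  by have := dfS S; rewrite (negbTE mS) add0r.
(* For positive [i] this is the induction hypothesis. For $i = 0$ the chain $f_2$ is a ring element
   whose multiple by $x_m$ lies in the initial ideal, so regularity makes it a combination of the
   earlier $x_l$. *)
have [y2 [cy2 sy2 dy2]] : exists y,
    [/\ koszul_chain i.+1 y, supp m y & koszul_d x y = f2].
  case: i c2 d1 {dfS dfE df cf c1} => [|i] c2 d1; last exact: (IH (ltnW kn) i f2 c2 s2 d2).
  have [a aE] : exists a : 'I_n -> R,
      f2 finset.set0 = \sum_l a l * (if (l < k)%N then x l else 0).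
    apply/gen_rangeP; apply: (reg m); apply/gen_rangeP.
    exists (fun l => - f1 [set l]%SET); have := d1 finset.set0.
    rewrite expr0 mul1r addrC => /eqP; rewrite addr_eq0 => /eqP->.
    rewrite koszul_dE -sumrN; apply: eq_big => [l|l _]; first by rewrite inE.
    rewrite finset.setU0 below_set0.
    rewrite expr0 mul1r mulNr [in RHS]mulrC; case: ifPn => // lk.
    rewrite s1 ?mulr0 ?mul0r //.
    by apply/forall_inPn; exists l; rewrite ?inE.
  pose y : {ffun {set 'I_n} -> R} :=
    [ffun S : {set 'I_n} => \sum_(l : 'I_n | (l < k)%N && (S == [set l]%SET)) a l].
  have cy : koszul_chain 1 y.
    move=> S S1; rewrite ffunE big_pred0 // => l; apply/negbTE.
    by apply: contraNN S1 => /andP[_ /eqP->]; rewrite cards1.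
  exists y; split=> //.
    move=> S /forall_inPn[j jS jk]; rewrite ffunE big_pred0 // => l.
    apply/negbTE; apply: contraNN jk => /andP[lk /eqP Sl].
    by move: jS; rewrite Sl inE => /eqP->.
  apply/ffunP => S; have [->|Sn0] := eqVneq S finset.set0; last first.
    by rewrite (koszul_d_chain cy) ?c2 // cards_eq0.
  rewrite koszul_dE aE; apply: eq_big => [l|l _]; first by rewrite inE.
  rewrite finset.setU0 below_set0.
  rewrite expr0 mul1r mulrC ffunE; case: ifPn => lk.
    rewrite (big_pred1 l) // => j; rewrite /= eq_sym (inj_eq finset.set1_inj).
    by case: eqP => [->|]; rewrite ?lk ?andbF.
  rewrite mulr0 big_pred0 ?mul0r // => j; apply/negbTE.
  apply: contraNN lk => /andP[jk /eqP/finset.set1_inj->//].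
(* This is a cycle because $dy_2 = f_2$. If $dy_0 = h$, the last term of [h] cancels against that of
   $d(y_2 \wedge e_m)$, so $y_0 + y_2 \wedge e_m$ bounds [f]. *)
pose h : {ffun {set 'I_n} -> R} := [ffun S => f1 S + (-1) ^+ i * x m * y2 S].
have [|||y0 [cy0 sy0 dy0]] := IH (ltnW kn) i h.
- by move=> S Si; rewrite ffunE c1 // cy2 // mulr0 addr0.
- by move=> S Sk; rewrite ffunE s1 // sy2 // mulr0 addr0.
- rewrite koszul_d_linear dy2; apply/ffunP => S; rewrite !ffunE.
  by have := d1 S; rewrite !ffunE.
exists [ffun S => y0 S + 1 * wedge m y2 S]; split.
- move=> S Si; rewrite ffunE cy0 // add0r ffunE; case: ifP => [mS|_]; last by rewrite mulr0.
  by rewrite cy2 ?mulr0 //; move: Si; rewrite (cardsD1 m S) mS.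
- move=> S Sk; rewrite ffunE sy0; last first.
    apply: contraNN Sk => /forall_inP Sk; apply/forall_inP => j /Sk.
    by move=> /ltnW.
  rewrite add0r ffunE; case: ifP => [mS|_]; last by rewrite mulr0.
  rewrite sy2 ?mulr0 //; apply: contraNN Sk => /forall_inP Sk.
  apply/forall_inP => j jS; have [->//|jm] := eqVneq j m.
  by rewrite ltnW // ltnS Sk // !inE jm.
rewrite koszul_d_linear dy0 (koszul_d_wedge cy2 sy2) dy2 [RHS]fE.
by apply/ffunP => S; rewrite !ffunE exprS; ring.
Qed.

Lemma koszul_acyclic :
  (forall (m : 'I_n) a, initial_ideal m (x m * a) -> initial_ideal m a) ->
  forall i, ~ koszul_homology_neq0 x i.+1.
Proof.
move=> reg i [z [cz dz nz]]; apply: nz.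
have [|y [cy _ dy]] := koszul_acyclic_supp (leqnn n) reg cz _ dz.
  by move=> S /forall_inPn[j]; rewrite ltn_ord.
by exists y.
Qed.

End KoszulComplex.

(** * Koszul homology and chains of primes *)

Section KoszulDimension.
Variables (R : comPzRingType) (M : ideal R).
Hypotheses (nR : noetherian R) (lM : local_at M).

Lemma minimal_over_refl (P : ideal R) : prime_ideal P -> minimal_over P P.
Proof. by split. Qed.

(** Vanishing in top degree yields $y \in M$ regular modulo [I]. Passing to $I + (y)$ raises the
    vanishing bound by one, and regularity gives one more prime below the resulting chain. *)
Lemma kexact_pchain n (x : 'I_n -> R) : M = ideal_gen (range x) ->
  forall d h (I : ideal R), (h + d)%N = n -> I `<=` M ->
  (forall i, (h < i)%N -> kexact x I i) ->
  exists2 P0 : ideal R, I `<=` P0 & pchain d P0 M.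
Proof.
move=> Mx; elim=> [|d IH] h I hdn IM exI.
  by exists M => //; apply: pchain0; exact: local_at_prime.
have xM j : M (x j) by rewrite Mx; apply: sub_gen; exists j.
have [|y My yI] := @local_nonzerodivisor _ nR M I lM.
  move=> a Ma; apply: (@kexact_top _ _ x).
    by apply: exI; rewrite -hdn addnS ltnS leq_addr.
  by move=> j; exact: Ma.
have [|||P1 yP1 cP1] := IH h.+1 (adj I y).
- by rewrite addSnnS.
- exact: adj_sub.
- by case=> [//|i] hi; apply: kexact_adj => //; apply: exI => //; exact: ltnW.
have PP1 := pchain_primel cP1.
have IP1 : I `<=` P1 by move=> z Iz; apply: yP1; exact: sub_adj.
(* These products miss [I] as [y] is regular modulo [I]. A prime over [I] missing them lies inside
   [P1] and omits [y]. *)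
pose S := [set z | exists k s, ~ P1 s /\ z = y ^+ k * s].
have [||z Iz [k [s [ns e]]]|Q [PQ IQ QS]] := @prime_avoiding _ nR I S.
- by exists 0%N, 1; split; [case: PP1|rewrite mulr1].
- move=> _ _ [k [s [ns ->]]] [l [t [nt ->]]].
  exists (k + l)%N, (s * t); split; first exact: prime_mul.
  by rewrite exprD mulrACA.
- apply: ns; apply: IP1; move: Iz; rewrite e; elim: k {e} => [|k IHk].
    by rewrite mul1r.
  by rewrite exprS -mulrA => /yI.
exists Q => //; apply: pchain_cons cP1 => //; split=> [z Qz|P1Q].
  apply: contrapT => nz; apply: (QS _ Qz); exists 0%N, z.
  by rewrite mul1r.
have : Q y by apply: P1Q; apply: yP1; exact: adj_in.
by move=> /QS; apply; exists 1%N, 1; split; [case: PP1|rewrite mulr1].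
Qed.

Lemma adjs_perm (I : ideal R) s t : s =i t -> adjs I s = adjs I t.
Proof.
by move=> st; apply: ideal_ext; apply: adjs_sub => [|x xs]; try exact: sub_adjs;
  apply: adjs_in; [rewrite -st|rewrite st].
Qed.

Lemma height_ge_adjs (I P : ideal R) t d : height_ge I P (size t + d) ->
  height_ge (adjs I t) P d.
Proof.
move=> h s sd; rewrite -adjs_cat; apply: h.
by rewrite size_cat addnC ltn_add2l.
Qed.

(** Each initial ideal is prime by [height_ge_generators_prime], so regularity of the sequence
    reduces to $x_m$ not lying in the ideal of the earlier generators. *)
Lemma height_ge_koszul n (x : 'I_n -> R) : M = ideal_gen (range x) ->
  height_ge (zero_ideal R) M n -> forall i, ~ koszul_homology_neq0 x i.+1.
Proof.
move=> Mx hM; apply: koszul_acyclic => m a.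
pose s := [seq x i | i <- enum 'I_n].
have ss : size s = n by rewrite size_map size_enum_ord.
pose I := adjs (zero_ideal R) (take m s).
have sm i : nth 0 s (nat_of_ord i) = x i.
  by rewrite (nth_map i) ?size_enum_ord // nth_ord_enum.
have sE : s = take m s ++ x m :: drop m.+1 s.
  by rewrite -sm -drop_nth ?ss // cat_take_drop.
have -> : initial_ideal x m = I.
  apply: ideal_ext.
    apply: gen_sub => _ [l _ <-]; case: ifP => lm; last exact: ideal_0.
    apply: adjs_in; rewrite -sm -(nth_take 0 lm) mem_nth //.
    by rewrite size_take ss ltn_ord.
  apply: adjs_sub; first exact: zero_sub.
  move=> z /(nthP 0)[l]; rewrite size_take ss ltn_ord => lm <-.
  rewrite nth_take //; have ln := ltn_trans lm (ltn_ord m).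
  by apply: sub_gen; exists (Ordinal ln) => //=; rewrite lm -sm.
have ME : M = adjs I (x m :: drop m.+1 s).
  rewrite Mx gen_rangeE -/s [in LHS]sE -adjs_cat; apply: adjs_perm => z.
  by rewrite !mem_cat orbC.
have hI : height_ge I M (size (x m :: drop m.+1 s)).
  apply: height_ge_adjs; rewrite -size_cat -sE ss; exact: hM.
have PI := height_ge_generators_prime nR lM ME hI.
(* If $x_m \in I$, then [M] is generated over [I] by one element fewer than its height. *)
case: (PI) => _ /[apply] -[Ixm|//]; exfalso.
apply: (hI (drop m.+1 s)) => //=.
suff <- : M = adjs I (drop m.+1 s) by apply: minimal_over_refl; exact: local_at_prime.
rewrite ME /=; apply: ideal_ext; last exact: sub_adj.
by apply: adj_sub => //; exact: sub_adjs.
Qed.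

End KoszulDimension.

(** * Dimension and completion *)

Section Dimension.
Variables (R : comPzRingType) (M : ideal R).
Hypothesis lM : local_at M.
Implicit Types (I J P Q : ideal R).

(** A chain that stops short of [M] is lengthened by appending [M], hence only $d \le k$. *)
Lemma prime_chain_pchain d : prime_chain R d ->
  exists P0 k, (d <= k)%N /\ pchain k P0 M.
Proof.
move=> [c [pc cc]].
have {cc} cd k : (k <= d)%N -> pchain k (c 0%N) (c k).
  elim: k => [|k IH] kd; first by apply: pchain0; exact: pc.
  by apply: pchainS (IH (ltnW kd)) _ _; [exact: pc|exact: cc].
have PM := local_at_prime lM; have [nd _] := pc d (leqnn d).
have cM : c d `<=` M by exact: local_at_sub.
exists (c 0%N); have [Mc|nMc] := pselect (M `<=` c d).
  by exists d; split=> //; rewrite (ideal_ext Mc cM); exact: cd.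
by exists d.+1; split=> //; apply: pchainS (cd d _) _ _.
Qed.

Lemma pchain_prime_chain d P Q : pchain d P Q -> prime_chain R d.
Proof.
suff: pchain d P Q -> exists c : nat -> ideal R, [/\ c d = Q,
    forall i, (i <= d)%N -> prime_ideal (c i) & forall i, (i < d)%N -> c i `<` c i.+1].
  by move=> /[apply] -[c [_ pc cc]]; exists c.
elim=> [{}P PP|k {}P {}Q Q' _ [c [cQ pc cc]] PQ' QQ']; first by exists (fun=> P).
exists (fun i => if (i <= k)%N then c i else Q'); split=> [|i ik|i].
- by rewrite ltnn.
- by case: ifP => [/pc|].
rewrite ltnS => ik; rewrite ik; have [ik'|ki] := ltnP i k; first exact: cc.
by have -> : i = k; [apply/eqP; rewrite eqn_leq ik ki|rewrite cQ].
Qed.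

Lemma height_ge_le I P d e : (d <= e)%N -> height_ge I P e -> height_ge I P d.
Proof. by move=> de h s sd; apply: h; exact: leq_trans sd de. Qed.

Lemma minimal_over_pow J n : J `<=` M -> ideal_pow M n `<=` J -> minimal_over J M.
Proof.
move=> JM MJ; split=> //; first exact: local_at_prime.
move=> Q PQ JQ _ z Mz; apply: (@prime_exp _ _ _ n PQ); apply: JQ; apply: MJ.
exact: pow_exp.
Qed.

Lemma zero_height_ge_generated d e : height_ge (zero_ideal R) M d ->
  generated_by M e -> (d <= e)%N.
Proof.
move=> hM /generated_byP[s <- Ms]; rewrite leqNgt; apply/negP => /hM; apply.
by rewrite -Ms; apply: minimal_over_refl; exact: local_at_prime.
Qed.

Section NoetherianDimension.
Hypothesis nR : noetherian R.

Lemma prime_chain_height_ge d : prime_chain R d -> height_ge (zero_ideal R) M d.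
Proof.
move=> /prime_chain_pchain[P0 [k [dk ck]]]; apply: (height_ge_le dk).
by apply: (pchain_height_ge nR _ ck); exact: zero_sub.
Qed.

Lemma regular_dims d : height_ge (zero_ideal R) M d -> generated_by M d ->
  krull_dim R d /\ embedding_dim M d.
Proof.
move=> hM gM; split; split=> //.
- have [|P0 _ cd] := height_ge_pchain nR (local_at_prime lM) _ hM.
    exact: zero_sub.
  exact: pchain_prime_chain cd.
- by move=> e /prime_chain_height_ge he; exact: zero_height_ge_generated he gM.
- by move=> e; exact: zero_height_ge_generated.
Qed.

Lemma regular_localI d : height_ge (zero_ideal R) M d -> generated_by M d ->
  regular_local R.
Proof.
move=> hM gM; split=> //; exists M; split; first exact: local_at_ring.
by exists d; exact: regular_dims.
Qed.

End NoetherianDimension.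

Definition quot_image J I : ideal (quot_ring J).
Proof.
exists [set u | exists2 z, I z & u = quot_pi J z].
- by exists 0; [exact: ideal_0|rewrite rmorph0].
- move=> _ _ [a Ia ->] [b Ib ->].
  by exists (a + b); [exact: ideal_D|rewrite rmorphD].
- move=> u _ [b Ib ->]; have [a ->] := quot_pi_surj u.
  by exists (a * b); [exact: ideal_M|rewrite rmorphM].
Defined.

(** The images of the powers of [M] become stationary, so $M^n \subseteq J + M \cdot M^n$ and
    Nakayama applies. *)
Lemma artinian_quot_pow J : fg M -> artinian (quot_ring J) ->
  exists n, ideal_pow M n `<=` J.
Proof.
move=> fM /(_ (fun n => quot_image J (ideal_pow M n)))[n|n Jn].
  by move=> _ [z Mz ->]; exists z => //; exact: ideal_powS.
exists n; apply: (nakayama_local lM); first exact: fg_pow.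
move=> z Mz; have : quot_image J (ideal_pow M n.+1) (quot_pi J z).
  by rewrite Jn ?leqnSn //; exists z.
by move=> [y My /quot_pi_eq Jzy]; exists (z - y), y; split=> //; rewrite subrK.
Qed.

Lemma artinian_residue : artinian (quot_ring M).
Proof.
have [nM uM] := lM => c cS.
have c1 n u : c n u -> u != 0 -> c n 1.
  have [x ->] := quot_pi_surj u => cx x0.
  have [|b bx] := uM x.
    move=> Mx; move/eqP: x0; apply; rewrite -(rmorph0 (quot_pi M)).
    by apply/quot_pi_eq; rewrite subr0.
  by rewrite -(rmorph1 (quot_pi M)) -bx rmorphM; exact: ideal_M.
have [cn1|/existsNP[N ncN]] := pselect (forall n, c n 1).
  by exists 0%N => n _; apply: ideal_ext => u _; apply: ideal_full; exact: cn1.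
have c0 n : (N <= n)%N -> c n = zero_ideal (quot_ring M).
  move=> Nn; apply: ideal_ext; last exact: zero_sub.
  have cnN : c n `<=` c N.
    by move: Nn => /subnK <-; elim: (n - N)%N => // k IH u /cS/IH.
  by move=> u /cnN cu; apply: contrapT => /eqP u0; apply: ncN; exact: c1 cu u0.
by exists N => n Nn; rewrite !c0.
Qed.

End Dimension.

Definition ideal_preim (R S : comPzRingType) (f : {rmorphism R -> S}) (I : ideal S) :
  ideal R.
Proof.
exists [set x | I (f x)]; rewrite /=.
- by rewrite rmorph0; exact: ideal_0.
- by move=> x y Ix Iy; rewrite rmorphD; exact: ideal_D.
- by move=> a x Ix; rewrite rmorphM; exact: ideal_M.
Defined.

(** * Completions onto which the ring maps surjectively *)

Section SurjectiveCompletion.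
Variables (R : comPzRingType) (M : ideal R).
Implicit Types (r z : R) (s : seq R).

Fact complete_subproof r : ((fun n => quot_pi (ideal_pow M n) r) :
  prod_ring (fun n => quot_ring (ideal_pow M n))) \in coherent (I := M).
Proof. by apply/coherentP => n; exists r. Qed.

Definition complete r : completion M := Completion (complete_subproof r).

Lemma completion_ext (f g : completion M) :
  (forall n, completion_val f n = completion_val g n) -> f = g.
Proof. by move=> fg; apply: val_inj; apply: functional_extensionality_dep. Qed.

Fact complete_zmod_morphism : zmod_morphism complete.
Proof. by move=> x y; apply: completion_ext => n; exact: (rmorphB (quot_pi (ideal_pow M n))). Qed.
Fact complete_monoid_morphism : monoid_morphism complete.
Proof.
split; first exact: completion_ext.
by move=> x y; apply: completion_ext => n; rewrite /= -quot_piM.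
Qed.
HB.instance Definition _ :=
  GRing.isZmodMorphism.Build R (completion M) complete complete_zmod_morphism.
HB.instance Definition _ :=
  GRing.isMonoidMorphism.Build R (completion M) complete complete_monoid_morphism.

Definition completion_ker (n : nat) : ideal (completion M).
Proof.
exists [set f : completion M | completion_val f n = 0] => //.
- by move=> f g /= f0 g0; rewrite -[RHS]addr0 -{1}f0 -g0.
- by move=> f g /= g0; rewrite -[RHS](mulr0 (completion_val f n)) -g0.
Defined.

Lemma complete_ker n r : completion_ker n (complete r) <-> ideal_pow M n r.
Proof.
rewrite -[r in X in _ <-> X]subr0 -quot_pi_eq rmorph0.
by split.
Qed.

Lemma complete_eq r z : complete r = complete z <-> forall n, ideal_pow M n (r - z).
Proof.
split=> [rz n|rz]; first apply/quot_pi_eq.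
  by have := congr1 (fun f : completion M => completion_val f n) rz.
by apply: completion_ext => n; apply/quot_pi_eq.
Qed.

Lemma complete_ker1 r : completion_ker 1 (complete r) <-> M r.
Proof. by rewrite complete_ker pow1. Qed.

Hypothesis lM : local_at M.
Hypothesis fM : fg M.
(** The completion is then $R / \bigcap_n M^n$, and its elements, generators and parameters are
    handled through lifts. For ultraproducts this comes from saturation. *)
Hypothesis surj : forall f : completion M, exists r, f = complete r.

Notation S := (completion M).
Notation MS := (completion_ker 1).

Lemma completion_local : local_at MS.
Proof.
have [nM uM] := lM; split.
  by rewrite -(rmorph1 complete) complete_ker1.
move=> f; have [r ->] := surj f; rewrite complete_ker1 => /uM[b br].
by exists (complete b); rewrite -rmorphM br rmorph1.
Qed.

Lemma complete_adjs s r : adjs (zero_ideal R) s r ->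
  adjs (zero_ideal S) (map complete s) (complete r).
Proof.
elim: s r => [_ ->|x s IH _ [a [b [/IH sa ->]]]]; first exact: rmorph0.
by exists (complete a), (complete b); rewrite rmorphD rmorphM.
Qed.

Lemma adjs_complete s f : adjs (zero_ideal S) (map complete s) f ->
  exists2 r, adjs (zero_ideal R) s r & f = complete r.
Proof.
elim: s f => [_ ->|x s IH _ [_ [h [/IH[a sa ->] ->]]]].
  by exists 0; rewrite ?rmorph0.
have [b ->] := surj h; exists (a + b * x); first by exists a, b.
by rewrite rmorphD rmorphM.
Qed.

Lemma complete_seq (t : seq S) : exists2 s, size s = size t & t = map complete s.
Proof.
elim: t => [|f t [s _ ->]]; first by exists [::].
by have [r ->] := surj f; exists (r :: s); rewrite //= size_map.
Qed.

Lemma completion_maximal s : M = adjs (zero_ideal R) s ->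
  MS = adjs (zero_ideal S) (map complete s).
Proof.
move=> Ms; apply: ideal_ext => f.
  have [r ->] := surj f; move=> /complete_ker1; rewrite {1}Ms.
  exact: complete_adjs.
by move=> /adjs_complete[r sr ->]; apply/complete_ker1; rewrite Ms.
Qed.

Lemma complete_pow n r : ideal_pow MS n (complete r) <-> ideal_pow M n r.
Proof.
split.
  move=> h; apply/complete_ker; move: (complete r) h; apply: pow_sub => u Mu.
  have /choice[v vP] j : exists x, u j = complete x /\ M x.
    have [x ux] := surj (u j); exists x; split=> //.
    by apply/complete_ker1; rewrite -ux; exact: Mu.
  rewrite (eq_bigr (fun j => complete (v j))) => [|j _]; last by case: (vP j).
  by rewrite -rmorph_prod; apply/complete_ker; apply: pow_prod => j; case: (vP j).
have -> : ideal_pow MS n (complete r) = ideal_preim complete (ideal_pow MS n) r by [].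
move: r; apply: pow_sub => u Mu; rewrite /ideal_has /= rmorph_prod.
by apply: pow_prod => j; apply/complete_ker1; exact: Mu.
Qed.

(** The error lies in $\bigcap_n M^n$ and dies in the completion, where finitely generated ideals
    thus become closed. *)
Hypothesis closed : forall J z, fg J ->
  (forall n, ideal_add J (ideal_pow M n) z) ->
  exists2 y, J y & forall n, ideal_pow M n (z - y).

Lemma completion_noetherian : noetherian S.
Proof.
have [s Ms] := fM; apply: (closed_noetherian completion_local).
  by exists (map complete s); exact: completion_maximal.
move=> _ [t ->] f fJ; have [s' _ tE] := complete_seq t.
have [z fE] := surj f; rewrite {t}tE {f}fE in fJ *.
have [||y sy zy] := @closed (adjs (zero_ideal R) s') z; first by exists s'.
  move=> n; have [_ [g [/adjs_complete[a sa ->] Mg e]]] := fJ n.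
  exists a, (z - a); split=> //; last by rewrite addrC subrK.
  by apply/complete_pow; rewrite rmorphB /= e [_ + g]addrC addrK.
by have /complete_eq -> := zy; exact: complete_adjs.
Qed.

(** Lifted to [R], the parameters satisfy $M^n \subseteq (s) + M^{n+1}$, and Nakayama removes the
    error term. *)
Lemma completion_parameters (t : seq S) : minimal_over (adjs (zero_ideal S) t) MS ->
  exists s n, [/\ size s = size t, adjs (zero_ideal R) s `<=` M &
    ideal_pow M n `<=` adjs (zero_ideal R) s].
Proof.
have [s st ->] := complete_seq t; move=> [PS sS minS].
have [|n Mn] := @local_pow_sub _ completion_noetherian _
    (adjs (zero_ideal S) (map complete s)) completion_local.
  move=> Q PQ sQ; apply: minS => //; apply: local_at_sub completion_local _.
  by case: PQ.
exists s, n; rewrite size_map; split=> //.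
  by move=> r sr; apply/complete_ker1; apply: sS; exact: complete_adjs.
apply: (nakayama_local lM); first exact: fg_pow.
move=> r Mr; have /adjs_complete[a sa /complete_eq ra] :
    adjs (zero_ideal S) (map complete s) (complete r).
  by apply: Mn; apply/complete_pow.
by exists a, (r - a); split=> //; [exact: ra n.+1|rewrite addrC subrK].
Qed.

Lemma completion_minimal_over s n : adjs (zero_ideal R) s `<=` M ->
  ideal_pow M n `<=` adjs (zero_ideal R) s ->
  minimal_over (adjs (zero_ideal S) (map complete s)) MS.
Proof.
move=> sM Ms; apply: (@minimal_over_pow _ _ completion_local _ n).
  by move=> f /adjs_complete[r /sM Mr ->]; apply/complete_ker1.
by move=> f; have [r ->] := surj f => /complete_pow/Ms; exact: complete_adjs.
Qed.

(** Lifts of generators generate [M] up to $M^2$, hence generate it by Nakayama. *)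
Lemma completion_generated d : generated_by MS d -> generated_by M d.
Proof.
move=> /generated_byP[t <- MSt]; have [s <- tE] := complete_seq t.
apply/generated_byP; exists s => //.
have sM : adjs (zero_ideal R) s `<=` M.
  move=> r sr; apply/complete_ker1; rewrite MSt tE; exact: complete_adjs.
apply: ideal_ext => //; apply: (nakayama_local lM) => // r Mr.
have /adjs_complete[a sa /complete_eq ra] :
    adjs (zero_ideal S) (map complete s) (complete r).
  by rewrite -tE -MSt; apply/complete_ker1.
exists a, (r - a); split=> //; last by rewrite addrC subrK.
have := ra 2; have -> : ideal_pow M 2 = ideal_mul M (ideal_pow M 1) by [].
by rewrite pow1.
Qed.

End SurjectiveCompletion.

(** * Ultraproducts *)

Section Ultrafilter.
Variables (W : Type) (F : set_system W).
Context {UF : UltraFilter F}.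

Lemma ultra_not (B : set W) : ~ F B -> \forall w \near F, ~ B w.
Proof. by move=> nB; have [|//] := in_ultra_setVsetC B UF. Qed.

Lemma ultra_contra (B : set W) : ~ (\forall w \near F, ~ B w) -> F B.
Proof. by move=> h; apply: contrapT => /ultra_not. Qed.

Lemma ultra_pigeonhole n (B : nat -> set W) :
  (\forall w \near F, exists2 k, (k < n)%N & B k w) -> exists2 k, (k < n)%N & F (B k).
Proof.
elim: n => [h|n IH h].
  by have [w [k]] := filter_ex h.
have [FB|nFB] := pselect (F (B n)); first by exists n.
have [|k kn Bk] := IH; last by exists k => //; exact: ltnW.
have nB := ultra_not nFB; near=> w.
have [k + Bk] : exists2 k, (k < n.+1)%N & B k w by near: w.
rewrite ltnS leq_eqVlt => /predU1P[kn|kn]; last by exists k.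
by exfalso; have : ~ B n w; [near: w|rewrite -kn].
Unshelve. all: by end_near. Qed.

Lemma family_choice (T : W -> Type) (t0 : forall w, T w) (B : forall w, T w -> Prop) :
  exists t : forall w, T w, forall w, (exists u, B w u) -> B w (t w).
Proof.
have h w : {u : T w | (exists v, B w v) -> B w u}.
  have [ex|nex] := pselect (exists v, B w v).
    by have [u Bu] := cid ex; exists u.
  by exists (t0 w).
by exists (fun w => sval (h w)) => w; exact: svalP (h w).
Qed.

Lemma near_choice (T : W -> Type) (t0 : forall w, T w) (B : forall w, T w -> Prop) :
  (\forall w \near F, exists u, B w u) ->
  exists t : forall w, T w, \forall w \near F, B w (t w).
Proof.
move=> h; have [t tB] := family_choice t0 B; exists t.
by apply: filterS h => w; exact: tB.
Qed.

(** Countable saturation: at each [w] the strongest solvable condition is solved. Incompleteness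
    caps its index, since almost every [w] leaves some [C m]. *)
Lemma saturation (T : W -> Type) (t0 : forall w, T w)
    (B : nat -> forall w, T w -> Prop) : countably_incomplete F ->
  (forall n w t, B n.+1 w t -> B n w t) ->
  (forall n, \forall w \near F, exists t, B n w t) ->
  exists t : forall w, T w, forall n, \forall w \near F, B n w (t w).
Proof.
move=> [C [FC nFC]] Bdec exB.
have Ble w t m n : (m <= n)%N -> B n w t -> B m w t.
  by move=> /subnK <-; elim: (n - m)%N => // k IH /Bdec/IH.
(* The sets [C k] need not decrease, hence the condition for all $k \le n$; it bounds the admissible
   [n] once [w] leaves one of them. *)
pose N w n := (exists t, B n w t) /\ forall k, (k <= n)%N -> C k w.
have [t tB] := family_choice t0
  (fun w u => exists n, [/\ N w n, forall k, N w k -> (k <= n)%N & B n w u]).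
exists t => n.
have FCn : \forall w \near F, forall k, (k <= n)%N -> C k w.
  elim: n => [|n IH]; first by apply: filterS (FC 0%N) => w Cw [|k].
  apply: filterS2 IH (FC n.+1) => w Cw Cn k.
  by rewrite leq_eqVlt => /predU1P[->|/Cw].
have FnC := ultra_not nFC.
apply: filterS3 FCn (exB n) FnC => w Cw Bw nCw.
have Nwn : N w n by split.
have /existsNP[m nCm] : ~ forall m, C m w by move=> h; apply: nCw => m _; exact: h.
have bound k : `[< N w k >] -> (k <= m)%N.
  move=> /asboolP[_ Ck]; rewrite leqNgt; apply/negP => /ltnW mk; apply: nCm.
  exact: Ck.
have exN : exists k, `[< N w k >] by exists n; apply/asboolP.
have [k /asboolP Nk kmax] := ex_maxnP exN bound.
have [|j [_ jmax Bj]] := tB w.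
  have [[u Bu] _] := Nk; exists u, k; split=> // l Nl.
  by apply: kmax; apply/asboolP.
by apply: Ble Bj; exact: jmax.
Qed.

End Ultrafilter.

(** * Transfer of ideals and Koszul homology *)

Section Ultraproduct.
Variables (W : Type) (F : set_system W).
Context {UF : UltraFilter F}.
Variable A : W -> comPzRingType.

Notation R := (ultraproduct F A).
Notation upi := (quot_pi (null_ideal (@ultra_proper W F UF) A)).

Lemma upi_eq (f g : prod_ring A) :
  upi f = upi g :> R <-> \forall w \near F, f w = g w.
Proof.
have fgE w : (f - g) w = f w - g w by [].
rewrite quot_pi_eq; split; apply: filterS => w; rewrite /= fgE.
  by move=> /eqP; rewrite subr_eq0 => /eqP.
by move=> ->; rewrite subrr.
Qed.

Lemma upi_surj (r : R) : exists f, r = upi f.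
Proof. exact: quot_pi_surj. Qed.

Lemma prod_sumE (T : finType) (p : pred T) (f : T -> prod_ring A) w :
  (\sum_(i | p i) f i) w = \sum_(i | p i) f i w.
Proof. by apply: (big_morph (fun f : prod_ring A => f w)). Qed.

Lemma prod_prodE (T : finType) (p : pred T) (f : T -> prod_ring A) w :
  (\prod_(i | p i) f i) w = \prod_(i | p i) f i w.
Proof. by apply: (big_morph (fun f : prod_ring A => f w)). Qed.

Lemma upi_near_choice (B : forall w, A w -> Prop) :
  (\forall w \near F, exists u, B w u) ->
  exists f : prod_ring A, \forall w \near F, B w (f w).
Proof. exact: (near_choice (fun w => 0 : A w)). Qed.

Implicit Types I J : forall w, ideal (A w).

Definition uideal I : ideal R.
Proof.
exists [set r | exists2 f, r = upi f & \forall w \near F, I w (f w)].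
- by exists 0; [rewrite rmorph0|apply: filterE => w; exact: ideal_0].
- move=> _ _ [f -> If] [g -> Ig]; exists (f + g); first by rewrite rmorphD.
  by apply: filterS2 If Ig => w; exact: ideal_D.
- move=> r _ [g -> Ig]; have [f ->] := upi_surj r.
  exists (f * g); first by rewrite rmorphM.
  by apply: filterS Ig => w; exact: ideal_M.
Defined.

Lemma uidealP I f : uideal I (upi f) <-> \forall w \near F, I w (f w).
Proof.
split=> [[g /upi_eq fg Ig]|If]; last by exists f.
by apply: filterS2 fg Ig => w ->.
Qed.

Lemma uideal_sub I J : (\forall w \near F, I w `<=` J w) -> uideal I `<=` uideal J.
Proof.
move=> IJ r; have [f ->] := upi_surj r => /uidealP If; apply/uidealP.
by apply: filterS2 IJ If => w; apply.
Qed.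

(** Counterexamples chosen on a set of the ultrafilter would form an element of the ultraproduct
    violating the inclusion. *)
Lemma uideal_sub_near I J : uideal I `<=` uideal J -> \forall w \near F, I w `<=` J w.
Proof.
move=> IJ; apply: ultra_contra => nIJ.
have [|f nf] := @upi_near_choice (fun w u => I w u /\ ~ J w u).
  apply: filterS nIJ => w /existsNP[u /not_implyP[Iu nJu]]; by exists u.
have /IJ/uidealP Jf : uideal I (upi f) by apply/uidealP; apply: filterS nf => w [].
have [w []] := filter_ex (filterI nf Jf).
by move=> [].
Qed.

Lemma uideal_eq I J : (\forall w \near F, I w = J w) -> uideal I = uideal J.
Proof.
by move=> IJ; apply: ideal_ext; apply: uideal_sub; apply: filterS IJ => w ->.
Qed.

Lemma uideal_inj I J : uideal I = uideal J -> \forall w \near F, I w = J w.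
Proof.
move=> IJ; have IJ1 : uideal I `<=` uideal J by rewrite IJ.
have JI1 : uideal J `<=` uideal I by rewrite IJ.
apply: filterS2 (uideal_sub_near IJ1) (uideal_sub_near JI1) => w.
exact: ideal_ext.
Qed.

Lemma uideal_gen n (x : 'I_n -> prod_ring A) :
  uideal (fun w => ideal_gen (range (fun i => x i w))) =
  ideal_gen (range (fun i => upi (x i) : R)).
Proof.
apply: ideal_ext => r; have [f ->] := upi_surj r.
  move=> /uidealP h.
  have [|a ha] := @near_choice _ _ _ (fun w => 'I_n -> A w) (fun w _ => 0)
    (fun w u => f w = \sum_i u i * x i w).
    by apply: filterS h => w /gen_rangeP.
  apply/gen_rangeP; exists (fun i => upi (fun w => a w i)).
  under eq_bigr do rewrite -rmorphM.
  rewrite -rmorph_sum; apply/upi_eq; apply: filterS ha => w ->.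
  by rewrite prod_sumE.
move=> /gen_rangeP[a e].
have /choice[b bP] i : exists g, a i = upi g by exact: upi_surj.
apply/uidealP; move: e; under eq_bigr do rewrite bP -rmorphM.
rewrite -rmorph_sum => /upi_eq; apply: filterS => w e; apply/gen_rangeP.
by exists (fun i => b i w); rewrite e prod_sumE.
Qed.

Lemma uideal_colon J (b : prod_ring A) :
  uideal (fun w => ideal_colon (J w) (b w)) = ideal_colon (uideal J) (upi b).
Proof.
apply: ideal_ext => r; have [f ->] := upi_surj r.
  move=> /uidealP h; have : uideal J (upi (f * b)) by apply/uidealP.
  by rewrite rmorphM.
move=> h; have /uidealP {}h : uideal J (upi (f * b)) by rewrite rmorphM.
by apply/uidealP.
Qed.

Lemma uideal_prime I : (\forall w \near F, prime_ideal (I w)) -> prime_ideal (uideal I).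
Proof.
move=> PI; split.
  rewrite -(rmorph1 upi) => /uidealP I1.
  by have [w [[]]] := filter_ex (filterI PI I1).
move=> r s; have [f ->] := upi_surj r; have [g ->] := upi_surj s.
rewrite -rmorphM => /uidealP Ifg.
have [If|/ultra_not nIf] := pselect (F [set w | I w (f w)]); first by left; apply/uidealP.
right; apply/uidealP; near=> w.
have [_ /(_ (f w) (g w))] : prime_ideal (I w) by near: w.
case=> //; first by near: w.
by have : ~ I w (f w); [near: w|].
Unshelve. all: by end_near. Qed.

Lemma prime_uideal I : prime_ideal (uideal I) -> \forall w \near F, prime_ideal (I w).
Proof.
move=> [nI PI]; apply: ultra_contra => nP.
have [|f hf] := @near_choice _ _ _ (fun w => (A w * A w)%type) (fun w => (0, 0))
    (fun w u => [/\ I w (u.1 * u.2), ~ I w u.1 & ~ I w u.2]).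
  have nI1 : \forall w \near F, ~ I w 1.
    by apply: ultra_not => h; apply: nI; rewrite -(rmorph1 upi); apply/uidealP.
  apply: filterS2 nP nI1 => w nPw nw; apply: contrapT => nex; apply: nPw; split=> //.
  move=> u v Iuv; apply: contrapT => /not_orP[nu nv]; apply: nex.
  by exists (u, v).
have : uideal I (upi (fun w => (f w).1) * upi (fun w => (f w).2)).
  by rewrite -rmorphM; apply/uidealP; apply: filterS hf => w [].
by move=> /PI[] /uidealP h; have [w [[_ ? ?]]] := filter_ex (filterI hf h).
Qed.

Section Local.
Variable M : forall w, ideal (A w).
Hypothesis lM : forall w, local_at (M w).

Notation UM := (uideal M).

Lemma uideal_local : local_at UM.
Proof.
split.
  rewrite -(rmorph1 upi) => /uidealP h; have [w] := filter_ex h.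
  by have [] := lM w.
move=> r; have [f ->] := upi_surj r => nf.
have [|b hb] := @upi_near_choice (fun w u => u * f w = 1).
  have : ~ F [set w | M w (f w)] by move=> h; apply/nf/uidealP.
  by move=> /ultra_not; apply: filterS => w; have [_] := lM w; apply.
by exists (upi b); rewrite -rmorphM -(rmorph1 upi); apply/upi_eq.
Qed.

Lemma uideal_pow_sub n : ideal_pow UM n `<=` uideal (fun w => ideal_pow (M w) n).
Proof.
apply: pow_sub => u Mu.
have /choice[v vP] i : exists g, u i = upi g by exact: upi_surj.
rewrite (eq_bigr (fun i => upi (v i))) => [|i _]; last exact: vP.
rewrite -rmorph_prod; apply/uidealP.
have h : \forall w \near F, forall i, M w (v i w).
  by apply: filter_forall => i; apply/uidealP; rewrite -vP.
apply: filterS h => w Mw; rewrite prod_prodE; exact: pow_prod.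
Qed.

(** A failure is witnessed in each factor by a product of exactly [n] elements, and such families
    are products of [n] elements of [UM]. *)
Lemma uideal_pow_near n J : ideal_pow UM n `<=` uideal J ->
  \forall w \near F, ideal_pow (M w) n `<=` J w.
Proof.
move=> MJ; apply: ultra_contra => nMJ.
have [|u hu] := @near_choice _ _ _ (fun w => 'I_n -> A w) (fun w _ => 0)
    (fun w u => (forall i, M w (u i)) /\ ~ J w (\prod_i u i)).
  apply: filterS nMJ => w nw; apply: contrapT => nex; apply: nw.
  apply: pow_sub => u Mu; apply: contrapT => nJu; apply: nex.
  by exists u.
have /MJ : ideal_pow UM n (\prod_i upi (fun w => u w i)).
  by apply: pow_prod => i; apply/uidealP; apply: filterS hu => w [].
rewrite -rmorph_prod => /uidealP h.
have [w [[_ nJ]]] := filter_ex (filterI hu h).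
by rewrite prod_prodE.
Qed.

Variables (m : nat) (x : 'I_m -> prod_ring A).
Hypothesis Mx : \forall w \near F, M w = ideal_gen (range (fun i => x i w)).

Lemma uideal_genM : UM = ideal_gen (range (fun i => upi (x i) : R)).
Proof. by rewrite -uideal_gen; exact: uideal_eq. Qed.

(** The number [m] of summands is the same for almost all [w], so the sums reassemble into a finite
    sum in the ultraproduct. *)
Lemma uideal_mul_sub J (K : ideal R) : uideal J `<=` K ->
  uideal (fun w => ideal_mul (M w) (J w)) `<=` ideal_mul UM K.
Proof.
move=> JK r; have [f ->] := upi_surj r => /uidealP h.
have [|b hb] := @near_choice _ _ _ (fun w => 'I_m -> A w) (fun w _ => 0)
    (fun w b => (forall i, J w (b i)) /\ f w = \sum_i x i w * b i).
  apply: filterS2 Mx h => w -> {}h.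
  have := @mul_gen_range _ _ (fun i => x i w) (J w) _ h.
  by move=> [b Jb ->]; exists b.
rewrite (_ : upi f = \sum_i upi (x i) * upi (fun w => b w i)).
  apply: (@ideal_sum _ (ideal_mul UM K)) => i _; apply: mul_in.
    by rewrite uideal_genM; apply: sub_gen; exists i.
  by apply: JK; apply/uidealP; apply: filterS hb => w [].
under eq_bigr do rewrite -rmorphM.
rewrite -rmorph_sum; apply/upi_eq; apply: filterS hb => w [_ ->].
by rewrite prod_sumE.
Qed.

Lemma uideal_powE n : uideal (fun w => ideal_pow (M w) n) = ideal_pow UM n.
Proof.
apply: ideal_ext; last exact: uideal_pow_sub.
by elim: n => [//|n IH]; exact: uideal_mul_sub.
Qed.

Lemma upi_powP n f : ideal_pow UM n (upi f) <-> \forall w \near F, ideal_pow (M w) n (f w).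
Proof. by rewrite -uideal_powE; exact: uidealP. Qed.

Hypothesis Finc : countably_incomplete F.

Lemma ultraproduct_complete (f : completion UM) : exists r, f = complete UM r.
Proof.
have /choice[a aP] n : exists g : prod_ring A,
    completion_val f n = quot_pi (ideal_pow UM n) (upi g : R).
  have [r ->] := quot_pi_surj (completion_val f n).
  by have [g ->] := upi_surj r; exists g.
have aS n : \forall w \near F, ideal_pow (M w) n (a n.+1 w - a n w).
  apply/(upi_powP n (a n.+1 - a n)); rewrite rmorphB; apply/quot_pi_eq.
  rewrite -aP; apply/esym.
  by have /asboolP := valP f; apply; exact: aP.
(* Stated for all $k \le n$, the conditions weaken as [n] decreases; coherence makes [a n] a
   solution of the [n]-th. *)
pose B n w (t : A w) := forall k, (k <= n)%N -> ideal_pow (M w) k (t - a k w).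
have [||t tB] := @saturation _ _ _ (fun w => A w) (fun w => 0) B Finc.
- by move=> n w t h k kn; apply: h; exact: leqW.
- move=> n; suff: \forall w \near F, B n w (a n w).
    by apply: filterS => w Bw; exists (a n w).
  elim: n => [|n IH]; first by apply: filterE => w [|k] //.
  apply: filterS2 IH (aS n) => w Bw Sw k; rewrite leq_eqVlt => /predU1P[->|].
    by rewrite subrr; exact: ideal_0.
  rewrite ltnS => kn; rewrite -[a n.+1 w](subrK (a n w)) -addrA.
  by apply: ideal_D; [exact: (pow_le kn)|exact: Bw].
exists (upi t); apply: completion_ext => n; rewrite aP; apply/esym/quot_pi_eq.
rewrite -rmorphB; apply/upi_powP.
by apply: filterS (tB n) => w; apply.
Qed.

(** Saturation is applied to coefficient vectors of the fixed length [e]: those that represent [z]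
    modulo the [n]-th power are limited to one vector good for all [n]. *)
Lemma ultraproduct_closed (J : ideal R) z : fg J ->
  (forall n, ideal_add J (ideal_pow UM n) z) ->
  exists2 y, J y & forall n, ideal_pow UM n (z - y).
Proof.
move=> fJ; have [e [y0 ->]] : exists e, generated_by J e.
  by have [s Js] := fJ; exists (size s); apply/generated_byP; exists s.
have /choice[y yP] i : exists g, y0 i = upi g by exact: upi_surj.
have {y0 yP} -> : y0 = (fun i => upi (y i) : R) by apply/funext.
have [f ->] := upi_surj z => Jz.
pose B n w (c : 'I_e -> A w) := ideal_pow (M w) n (f w - \sum_i c i * y i w).
have [||c cB] := @saturation _ _ _ (fun w => 'I_e -> A w) (fun w _ => 0) B Finc.
- by move=> n w c; exact: ideal_powS.
- move=> n; have [a [b [/gen_rangeP[c0 aE] Mb fE]]] := Jz n.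
  have /choice[c cP] i : exists g, c0 i = upi g by exact: upi_surj.
  suff: \forall w \near F, B n w (fun i => c i w).
    by apply: filterS => w Bw; exists (fun i => c i w).
  have : ideal_pow UM n (upi (f - \sum_i c i * y i)).
    rewrite rmorphB rmorph_sum /= fE (_ : \sum_i _ = a) ?[a + b]addrC ?addrK //.
    by rewrite aE; apply: eq_bigr => i _; rewrite rmorphM cP.
  move=> /upi_powP; apply: filterS => w; rewrite /B.
  by rewrite (_ : (f - _) w = f w - (\sum_i c i * y i) w) // prod_sumE.
pose d i : prod_ring A := fun w => c w i.
exists (\sum_i upi (d i) * upi (y i)).
  by apply/gen_rangeP; exists (fun i => upi (d i)).
move=> n; under eq_bigr do rewrite -rmorphM.
rewrite -rmorph_sum -rmorphB; apply/upi_powP.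
apply: filterS (cB n) => w; rewrite /B.
by rewrite (_ : (f - _) w = f w - (\sum_i d i * y i) w) // prod_sumE.
Qed.

End Local.

Lemma koszul_d_upi n (x : 'I_n -> prod_ring A) (z : {set 'I_n} -> prod_ring A) S :
  koszul_d (fun j => upi (x j) : R) [ffun S => upi (z S)] S =
  upi (fun w => koszul_d (fun j => x j w) [ffun S => z S w] S).
Proof.
have signE k (a b : prod_ring A) : (-1) ^+ k * upi a * upi b = upi ((-1) ^+ k * a * b) :> R.
  by rewrite !rmorphM rmorphXn rmorphN1.
rewrite koszul_dE; under eq_bigr do rewrite ffunE signE.
rewrite -rmorph_sum; apply/upi_eq; apply: filterE => w.
rewrite prod_sumE koszul_dE; apply: eq_bigr => j _.
rewrite ffunE; congr (_ * _ * _).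
by elim: #|_| => [|k IH] //; rewrite !exprS -IH.
Qed.

Lemma ffun_upi n (z : {ffun {set 'I_n} -> R}) :
  exists y : {set 'I_n} -> prod_ring A, z = [ffun S => upi (y S)].
Proof.
have /choice[y yP] (S : {set 'I_n}) : exists g, z S = upi g by exact: upi_surj.
by exists y; apply/ffunP => S; rewrite ffunE.
Qed.

Lemma koszul_chain_upi n (z : {set 'I_n} -> prod_ring A) i :
  koszul_chain i [ffun S => upi (z S) : R] <->
  \forall w \near F, koszul_chain i [ffun S => z S w].
Proof.
split=> [cz|cz S Si].
  have h (S : {set 'I_n}) : \forall w \near F, #|S| != i -> z S w = 0.
    have [Si|Si] := boolP (#|S| != i); last by apply: filterE => w.
    have /upi_eq : upi (z S) = upi 0 :> R by rewrite rmorph0 -(cz S Si) ffunE.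
    by apply: filterS => w ->.
  have {}h : \forall w \near F, forall S : {set 'I_n}, #|S| != i -> z S w = 0.
    by apply: filter_forall; exact: h.
  apply: filterS h => w h S Si.
  by rewrite ffunE; exact: h.
rewrite ffunE -(rmorph0 upi); apply/upi_eq; apply: filterS cz => w /(_ S Si).
by rewrite ffunE.
Qed.

Lemma koszul_d_upi_eq n (x : 'I_n -> prod_ring A) (y z : {set 'I_n} -> prod_ring A) :
  koszul_d (fun j => upi (x j) : R) [ffun S => upi (y S)] = [ffun S => upi (z S)] <->
  \forall w \near F, koszul_d (fun j => x j w) [ffun S => y S w] = [ffun S => z S w].
Proof.
split=> [/ffunP yz|yz].
  have h (S : {set 'I_n}) :
      \forall w \near F, koszul_d (fun j => x j w) [ffun S => y S w] S = z S w.
    by have := yz S; rewrite koszul_d_upi ffunE => /upi_eq.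
  have {}h : \forall w \near F, forall S : {set 'I_n},
      koszul_d (fun j => x j w) [ffun S => y S w] S = z S w.
    by apply: filter_forall; exact: h.
  by apply: filterS h => w h; apply/ffunP => S; rewrite h ffunE.
apply/ffunP => S; rewrite koszul_d_upi ffunE; apply/upi_eq.
by apply: filterS yz => w ->; rewrite ffunE.
Qed.

Lemma ffun_family n (T : W -> Type) (z : forall w, {ffun {set 'I_n} -> T w}) w :
  [ffun S => z w S] = z w.
Proof. by apply/ffunP => S; rewrite ffunE. Qed.

(** A chain has $2^n$ coordinates, so cycles and boundaries transfer coordinate by coordinate. *)
Lemma ultraproduct_koszul n (x : 'I_n -> prod_ring A) i :
  koszul_homology_neq0 (fun j => upi (x j) : R) i <->
  \forall w \near F, koszul_homology_neq0 (fun j => x j w) i.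
Proof.
have zE : 0 = [ffun S : {set 'I_n} => upi 0 : R].
  by apply/ffunP => S; rewrite !ffunE rmorph0.
have zwE w : 0 = [ffun S : {set 'I_n} => (0 : prod_ring A) w].
  by apply/ffunP => S; rewrite !ffunE.
split=> [[z0 [cz dz nz]]|].
  have [z zP] := ffun_upi z0; rewrite {z0}zP in cz dz nz.
  move: cz dz => /koszul_chain_upi cz; rewrite zE => /koszul_d_upi_eq dz.
  apply: ultra_contra => nh; apply: nz.
  have [|y hy] := @near_choice _ _ _ (fun w => {ffun {set 'I_n} -> A w}) (fun w => 0)
      (fun w y => koszul_chain i.+1 y /\ koszul_d (fun j => x j w) y = [ffun S => z S w]).
    apply: filterS3 cz dz nh => w cz; rewrite -zwE => dz nh.
    by apply: contrapT => ny; apply: nh; exists [ffun S => z S w].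
  exists [ffun S => upi (fun w => y w S)]; split.
    apply/koszul_chain_upi; apply: filterS hy => w [+ _].
    by rewrite ffun_family.
  apply/koszul_d_upi_eq; apply: filterS hy => w [_ +].
  by rewrite ffun_family.
move=> hx.
have [|z hz] := @near_choice _ _ _ (fun w => {ffun {set 'I_n} -> A w}) (fun w => 0)
    (fun w z => [/\ koszul_chain i z, koszul_d (fun j => x j w) z = 0 &
      ~ exists y, koszul_chain i.+1 y /\ koszul_d (fun j => x j w) y = z]).
  by apply: filterS hx => w.
exists [ffun S => upi (fun w => z w S)]; split.
- apply/koszul_chain_upi; apply: filterS hz => w [+ _ _].
  by rewrite ffun_family.
- rewrite zE; apply/koszul_d_upi_eq; apply: filterS hz => w [_ + _].
  by rewrite ffun_family -zwE.
- move=> [y0 []]; have [y ->] := ffun_upi y0 => /koszul_chain_upi cy /koszul_d_upi_eq dy.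
  have [w [[_ _ nz] [cyw dyw]]] := filter_ex (filterI hz (filterI cy dy)).
  by apply: nz; exists [ffun S => y S w]; rewrite dyw ffun_family.
Qed.

End Ultraproduct.

(** * The equivalence *)

Lemma generated_by_le (R : comPzRingType) (I : ideal R) d e : (d <= e)%N ->
  generated_by I d -> generated_by I e.
Proof.
move=> de /generated_byP[s sd ->]; apply/generated_byP.
exists (nseq (e - d) 0 ++ s); first by rewrite size_cat size_nseq sd subnK.
apply: ideal_ext; apply: adjs_sub; try exact: zero_sub.
  by move=> x xs; apply: adjs_in; rewrite mem_cat xs orbT.
move=> x; rewrite mem_cat mem_nseq => /orP[/andP[_ /eqP->]|]; first exact: ideal_0.
exact: adjs_in.
Qed.

Lemma koszul_homology0 (R : comPzRingType) n (x : 'I_n -> R) :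
  ~ ideal_gen (range x) 1 -> koszul_homology_neq0 x 0.
Proof.
move=> nx; pose z : {ffun {set 'I_n} -> R} := [ffun S : {set 'I_n} => (#|S| == 0%N)%:R].
exists z; split.
- by move=> S /negbTE S0; rewrite ffunE S0.
- apply/ffunP => S; rewrite koszul_dE [RHS]ffunE big1 // => j jS.
  by rewrite ffunE cardsU1 jS mulr0.
move=> [y [_ yz]]; apply: nx; have <- : z finset.set0 = 1 by rewrite ffunE cards0.
rewrite -yz koszul_dE; apply: (@ideal_sum _ (ideal_gen (range x))) => j _.
by apply: ideal_Mr; apply: ideal_M; apply: sub_gen; exists j.
Qed.

Section UltraRegular.
Variables (W : Type) (F : set_system W).
Context {UF : UltraFilter F}.
Variables (A : W -> comPzRingType) (M : forall w, ideal (A w)).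
Hypothesis nA : forall w, noetherian (A w).
Hypothesis lM : forall w, local_at (M w).
Hypothesis Finc : countably_incomplete F.

Notation R := (ultraproduct F A).
Notation upi := (quot_pi (null_ideal (@ultra_proper W F UF) A)).
Notation UM := (uideal M).

Lemma upi_range n (y0 : 'I_n -> R) :
  exists y : 'I_n -> prod_ring A, y0 = (fun i => upi (y i)).
Proof.
have /choice[y yP] i : exists g, y0 i = upi g by exact: upi_surj.
by exists y; apply/funext.
Qed.

Lemma near_generated (I : forall w, ideal (A w)) n :
  (\forall w \near F, generated_by (I w) n) ->
  exists x : 'I_n -> prod_ring A,
    \forall w \near F, I w = ideal_gen (range (fun i => x i w)).
Proof.
move=> gI; have [x hx] := @near_choice _ _ _ (fun w => 'I_n -> A w) (fun w _ => 0)
  (fun w x => I w = ideal_gen (range x)) gI.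
by exists (fun i w => x w i).
Qed.

Lemma uideal_generated (I : forall w, ideal (A w)) n :
  generated_by (uideal I) n <-> \forall w \near F, generated_by (I w) n.
Proof.
split=> [[x0]|/near_generated[x hx]].
  have [x ->] := upi_range x0; rewrite -uideal_gen => /uideal_inj.
  by apply: filterS => w ->; exists (fun i => x i w).
by exists (fun i => upi (x i)); rewrite -uideal_gen; exact: uideal_eq.
Qed.

Lemma local_ring_uideal (N : ideal R) : local_ring N -> N = UM.
Proof.
by move=> [_ uN]; apply/esym/uN; have [] := local_at_ring (uideal_local lM).
Qed.

(** For almost all [w] the inclusions $M_w^n \subseteq (y_w) \subseteq M_w$ make $M_w$ minimal over
    an ideal with [size s] generators. *)
Lemma near_dim_le_parameters d (s : seq R) n :
  (\forall w \near F, height_ge (zero_ideal (A w)) (M w) d) ->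
  adjs (zero_ideal R) s `<=` UM -> ideal_pow UM n `<=` adjs (zero_ideal R) s ->
  (d <= size s)%N.
Proof.
have [y0 ->] : generated_by (adjs (zero_ideal R) s) (size s).
  by apply/generated_byP; exists s.
have [y ->] := upi_range y0; rewrite -uideal_gen.
move=> hM /uideal_sub_near yM /uideal_pow_near My.
have [w [hw [yw Mw]]] := filter_ex (filterI hM (filterI yM My)).
have mw := minimal_over_pow (lM w) yw Mw.
rewrite leqNgt; apply/negP => sd.
apply: (hw [seq y i w | i <- enum 'I_(size s)]); rewrite -?gen_rangeE //.
by rewrite size_map size_enum_ord.
Qed.

Lemma pseudo_regular_ultra_regular : pseudo_regular R -> ultra_regular F A.
Proof.
move=> [N [/local_ring_uideal {N}-> [d [[n [x0 [h [Mx [hh hmax] dE]]]] [gM _]]]]].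
have [x xE] := upi_range x0; rewrite {x0}xE in Mx hh hmax.
have hn : (h <= n)%N.
  rewrite leqNgt; apply/negP => nh.
  by move: hh; apply/(kexact_homology _ _).1; exact: kexact_large.
have exA : \forall w \near F, forall i, (h < i)%N -> ~ koszul_homology_neq0 (fun j => x j w) i.
  (* Homology lives in degrees at most [n], so if vanishing failed almost everywhere, it would fail
     in one fixed degree and survive in the ultraproduct. *)
  apply: ultra_contra => nex.
  have [|k _ hk] := @ultra_pigeonhole _ _ _ n.+1
      (fun k w => (h < k)%N /\ koszul_homology_neq0 (fun j => x j w) k).
    apply: filterS nex => w /existsNP[k /not_implyP[hk /contrapT Hk]].
    exists k => //; rewrite ltnS leqNgt; apply/negP => nk.
    by move: Hk; apply/(kexact_homology _ _).1; exact: kexact_large.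
  have [w [hkw _]] := filter_ex hk.
  suff /hmax : koszul_homology_neq0 (fun j => upi (x j) : R) k by rewrite leqNgt hkw.
  by apply/ultraproduct_koszul; apply: filterS hk => v [].
move: Mx; rewrite -uideal_gen => /uideal_inj Mx.
apply: filterS3 Mx exA ((uideal_generated _ _).1 gM) => w Mw exw gw /=.
apply: (regular_localI (lM w) (@nA w) _ gw).
have [||i hi|P0 _ cd] := kexact_pchain (@nA w) (lM w) Mw (d := d) (h := h) (I := zero_ideal _).
- by rewrite dE subnKC.
- exact: zero_sub.
- by apply/kexact_homology; exact: exw.
by apply: (pchain_height_ge (@nA w) _ cd); exact: zero_sub.
Qed.

Variables (m : nat) (x : 'I_m -> prod_ring A).
Hypothesis Mx : \forall w \near F, M w = ideal_gen (range (fun i => x i w)).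

Let fgUM : fg UM.
Proof. by rewrite (uideal_genM Mx) gen_rangeE; exists [seq upi (x i) | i <- enum 'I_m]. Qed.

Let lUM := uideal_local lM.
Let surj := @ultraproduct_complete _ _ _ _ _ _ _ Mx Finc.
Let closed := @ultraproduct_closed _ _ _ _ _ _ _ Mx Finc.
Let lMS := completion_local lUM surj.
Let nS := completion_noetherian lUM fgUM surj closed.

Section Regular.
Variable d : nat.
Hypothesis hM : \forall w \near F, height_ge (zero_ideal (A w)) (M w) d.
Hypothesis gM : generated_by UM d.

(** Fewer than [d] parameters of the completion would lift to parameters of [R], against
    [near_dim_le_parameters]. *)
Lemma near_regular_cata_regular : cata_regular R.
Proof.
exists UM; split; first exact: local_at_ring.
apply: (regular_localI lMS nS (d := d)).
  move=> t td /(completion_parameters lUM fgUM surj closed)[s [n [st sM Ms]]].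
  by have := near_dim_le_parameters hM sM Ms; rewrite st leqNgt td.
move: gM => /generated_byP[s sd Ms]; apply/generated_byP.
by exists (map (complete UM) s); [rewrite size_map|exact: completion_maximal].
Qed.

Lemma near_regular_geometric_dim : geometric_dim UM d.
Proof.
split=> [|e [y [yM artJ]]].
  move: gM => [y My]; exists y; split; first by rewrite My; exact: sub_gen.
  by rewrite -My; exact: artinian_residue lUM.
have [n Mn] := artinian_quot_pow lUM fgUM artJ.
rewrite gen_rangeE in Mn.
have := near_dim_le_parameters hM _ Mn; rewrite size_map size_enum_ord; apply.
by rewrite -gen_rangeE; exact: gen_sub.
Qed.

Lemma near_regular_pi_dim : pi_dim UM d.
Proof.
split=> [|e [_ [[y0 ->] [[_ [a0 +]] minJ]]]].
  (* The ideal [UM] is its own witness: every colon of [UM] contains [UM], so no associated prime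
     lies strictly below. *)
  exists UM; split=> //; split.
    split; first exact: local_at_prime.
    by exists 1; apply: ideal_ext => r; rewrite /ideal_colon /= mulr1.
  by move=> Q [_ [a ->]] [_]; apply => r; exact: (@ideal_Mr _ UM).
have [y yE] := upi_range y0; have [a ->] := upi_surj a0.
rewrite {y0 a0}yE -uideal_gen in minJ *.
pose J w := ideal_gen (range (fun i => y i w)).
rewrite -(uideal_colon J) => /uideal_inj MJ.
rewrite leqNgt; apply/negP => ed.
have [|b hb] := @upi_near_choice _ _ _ _
  (fun w b => prime_ideal (ideal_colon (J w) b) /\ ideal_colon (J w) b `<` M w).
  apply: filterS2 MJ hM => w Mw hw.
  have JM : J w `<=` M w by rewrite Mw => z Jz; exact: (@ideal_Mr _ (J w)).
  (* With only $e < d$ generators, [J w] has a prime over it strictly below [M w], and below that an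
     associated prime. The ultraproduct of the latter contradicts [minJ]. *)
  have [Q [PQ JQ QM]] : exists Q, [/\ prime_ideal Q, J w `<=` Q & Q `<` M w].
    apply: contrapT => nQ; apply: (hw [seq y i w | i <- enum 'I_e]).
      by rewrite size_map size_enum_ord.
    rewrite -gen_rangeE; split=> //; first exact: local_at_prime.
    move=> Q PQ JQ QM; apply: contrapT => nMQ; apply: nQ; exists Q.
    by split.
  have [b [Pb _ bQ]] := associated_prime_below (@nA w) PQ JQ.
  exists b; split=> //; split=> [z /bQ|Mb]; first exact: (proj1 QM).
  by apply: (proj2 QM) => z /Mb/bQ.
apply: (minJ (ideal_colon (uideal J) (upi b))).
  split; last by exists (upi b).
  by rewrite -uideal_colon; apply: uideal_prime; apply: filterS hb => w [].
rewrite -uideal_colon; split; first by apply: uideal_sub; apply: filterS hb => w [_ []].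
move=> /uideal_sub_near Mb; have [w [[_ [_ nMb]]]] := filter_ex (filterI hb Mb).
exact.
Qed.

Lemma near_regular_pseudo_regular : pseudo_regular R.
Proof.
exists UM; split; first exact: local_at_ring.
exists d; split; last first.
  split=> // e /uideal_generated ge; have [w [hw gw]] := filter_ex (filterI hM ge).
  exact: zero_height_ge_generated hw gw.
have [y hy] := near_generated ((uideal_generated _ _).1 gM).
have My : UM = ideal_gen (range (fun i => upi (y i) : R)).
  by rewrite -uideal_gen; exact: uideal_eq.
exists d, (fun i => upi (y i)), 0%N; split=> //; last by rewrite subn0.
split; first by apply: koszul_homology0; rewrite -My; case: lUM.
move=> [//|i] /ultraproduct_koszul hi.
have [w [hw [yw]]] := filter_ex (filterI hM (filterI hy hi)).
by move=> /(height_ge_koszul (@nA w) (lM w) yw hw).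
Qed.

End Regular.

(** The dimension of a regular factor is its embedding dimension, at most [m], so one value is taken
    almost everywhere. *)
Lemma ultra_regular_dim : ultra_regular F A -> exists d,
  (\forall w \near F, height_ge (zero_ideal (A w)) (M w) d) /\ generated_by UM d.
Proof.
move=> reg; have [|d _ hd] := @ultra_pigeonhole _ _ _ m.+1
    (fun d w => height_ge (zero_ideal (A w)) (M w) d /\ generated_by (M w) d).
  apply: filterS2 reg Mx => w [_ [N [[_ uN] [d [[pc _] [gN dmin]]]]]] Mw.
  have NM : M w = N by apply: uN; have [] := local_at_ring (lM w).
  rewrite -NM in gN dmin; exists d.
    by rewrite ltnS; apply: dmin; rewrite Mw; exists (fun i => x i w).
  by split=> //; exact: prime_chain_height_ge.
exists d; split; first by apply: filterS hd => w [].
by apply/uideal_generated; apply: filterS hd => w [].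
Qed.

Lemma cata_regular_isodimensional_dim : cata_regular R -> isodimensional R -> exists d,
  (\forall w \near F, height_ge (zero_ideal (A w)) (M w) d) /\ generated_by UM d.
Proof.
move=> [N [/local_ring_uideal-> {N} [_ [MS [[_ uMS] [d [[pc _] [gMS _]]]]]]]].
move=> [N [/local_ring_uideal-> {N} [g [[[y [yM artJ]] _] [_ gmin]]]]].
have MSE : completion_ker UM 1 = MS by apply: uMS; have [] := local_at_ring lMS.
rewrite -MSE in gMS; exists d; split; last exact: (completion_generated lUM fgUM surj).
(* Elements with Artinian quotient contain a power of [UM] in their ideal, so their images are
   parameters of the completion, whose dimension is [d]. *)
have dg : (d <= g)%N.
  have [n Mn] := artinian_quot_pow lUM fgUM artJ; rewrite gen_rangeE in Mn.
  have JM : adjs (zero_ideal R) [seq y i | i <- enum 'I_g] `<=` UM.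
    by rewrite -gen_rangeE; exact: gen_sub.
  have mJ := completion_minimal_over lUM surj JM Mn.
  rewrite leqNgt; apply/negP => gd.
  by apply: (prime_chain_height_ge lMS nS pc) mJ; rewrite size_map size_map size_enum_ord.
apply: ultra_contra => nh.
have [|e ed he] := @ultra_pigeonhole _ _ _ d (fun e w =>
    exists2 J, generated_by J e & minimal_over J (M w)).
  apply: filterS nh => w /existsNP[s /not_implyP[sd /contrapT ms]].
  exists (size s) => //; exists (adjs (zero_ideal (A w)) s) => //.
  by apply/generated_byP; exists s.
have [|J hJ] := @near_choice _ _ _ (fun w => ideal (A w)) (fun w => zero_ideal (A w))
    (fun w J => generated_by J e /\ minimal_over J (M w)).
  by apply: filterS he => w [J gJ mJ]; exists J.
have [|b hb] := @upi_near_choice _ _ _ _ (fun w b => M w = ideal_colon (J w) b).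
  apply: filterS hJ => w [_ [PM JM minJ]].
  have [b [Pb Jb bM]] := associated_prime_below (@nA w) PM JM.
  by exists b; apply: ideal_ext => //; exact: minJ.
suff : (g <= e)%N by rewrite leqNgt (leq_trans ed dg).
apply: gmin; exists (uideal J); split.
  by apply/uideal_generated; apply: filterS hJ => w [].
split.
  split; first exact: local_at_prime.
  by exists (upi b); rewrite -uideal_colon; exact: uideal_eq.
(* An associated prime inside [UM] is an ultraproduct of primes over [J w] inside [M w], so
   minimality of [M w] forces equality. *)
move=> Q [PQ [a0 QE]]; have [a aE] := upi_surj a0.
rewrite {}QE {a0}aE -uideal_colon in PQ *; move=> [/uideal_sub_near aM]; apply.
apply: uideal_sub; apply: filterS3 hJ aM (prime_uideal PQ) => w [_ [_ _ minJ]] aw Pw.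
by apply: minJ => // z Jz; exact: (@ideal_Mr _ (J w)).
Qed.

End UltraRegular.

Theorem theorem8p1 (W : Type) (F : set_system W) (UF : UltraFilter F)
    (W_infinite : infinite_set [set: W])
    (F_incomplete : countably_incomplete F)
    (F_non_principal : non_principal F)
    (A : W -> comPzRingType)
    (A_noetherian_local : forall w, noetherian_local (A w))
    (A_bounded : exists m : nat, F [set w | embedding_dim_le (A w) m]) :
  let R := ultraproduct F A in
  [<-> pseudo_regular R;
       ultra_regular F A;
       cata_regular R /\ isodimensional R].
Proof.
move=> R; have nA w : noetherian (A w) by case: (A_noetherian_local w).
have MP w : {M : ideal (A w) | local_ring M}.
  by apply: cid; case: (A_noetherian_local w).
pose M w := sval (MP w).
have lM w : local_at (M w) by apply: local_ring_at => //; exact: svalP.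
have [m hm] := A_bounded.
have [|x Mx] := @near_generated _ _ _ _ M m.
  apply: filterS hm => w [N [[_ uN] [d [gN _] dm]]].
  have -> : M w = N by apply: uN; have [] := local_at_ring (lM w).
  exact: generated_by_le dm gN.
tfae.
- exact: pseudo_regular_ultra_regular nA lM.
- move=> /(ultra_regular_dim nA lM Mx)[d [hM gM]]; split.
    exact: (near_regular_cata_regular lM F_incomplete Mx hM gM).
  exists (uideal M); split; first by apply: local_at_ring; exact: uideal_local.
  exists d; split; first exact: (near_regular_geometric_dim lM Mx hM gM).
  exact: (near_regular_pi_dim nA lM hM gM).
- move=> [cR iR].
  have [d [hM gM]] := cata_regular_isodimensional_dim nA lM F_incomplete Mx cR iR.
  exact: (near_regular_pseudo_regular nA lM hM gM).
Qed.
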